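(* Consider the problem $\min_{\mathbf{x}\in\mathbb{R}^m} f(\mathbf{x})=\frac1N\sum_{i=1}^N f_i(\mathbf{x})$ with $f_i(\mathbf{x})=\mathbb{E}_{\zeta_i\sim\mathcal{D}_i}[F_i(\mathbf{x};\zeta_i)]$, satisfying the smoothness (modulus $L$), bounded variance ($\sigma^2$) and bounded second moment ($G^2$) assumptions stated in the context. Let $\mathbf{x}_i^t$ be the iterates of Parallel Restarted SGD (described in the context) with learning rate $\gamma$ and synchronization interval $I$ (a positive integer), let $\overline{\mathbf{x}}^t=\frac1N\sum_{i=1}^N\mathbf{x}_i^t$, and let $f^\ast$ be the minimum value of $f$. Let $T\ge N$. 1. If $\gamma=\frac{\sqrt N}{L\sqrt T}$, then $$\frac1T\sum_{t=1}^T\mathbb{E}\left[\Vert\nabla f(\overline{\mathbf{x}}^{t-1})\Vert^2\right]\le\frac{2L}{\sqrt{NT}}\left(f(\overline{\mathbf{x}}^0)-f^\ast\right)+\frac{4N}{T}I^2G^2+\frac{1}{\sqrt{NT}}\sigma^2.$$ 2. If furthermore $I\le\frac{T^{1/4}}{N^{3/4}}$, then $$\frac1T\sum_{t=1}^T\mathbb{E}\left[\Vert\nabla f(\overline{\mathbf{x}}^{t-1})\Vert^2\right]\le\frac{2L}{\sqrt{NT}}\left(f(\overline{\mathbf{x}}^0)-f^\ast\right)+\frac{4}{\sqrt{NT}}G^2+\frac{1}{\sqrt{NT}}\sigma^2=O\left(\frac{1}{\sqrt{NT}}\right).$$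
   Context: Problem. $N\ge1$ is the number of workers; for $i\in\{1,\dots,N\}$, $\mathcal{D}_i$ is a probability distribution (possibly different for different $i$), $f_i(\mathbf{x})=\mathbb{E}_{\zeta_i\sim\mathcal{D}_i}[F_i(\mathbf{x};\zeta_i)]$ is a smooth, possibly non-convex function on $\mathbb{R}^m$, and $f=\frac1N\sum_{i=1}^N f_i$. Its minimum value is denoted $f^\ast$. $\Vert\cdot\Vert$ is the Euclidean norm and $\nabla F_i(\mathbf{x};\zeta)$ is the gradient in $\mathbf{x}$. Stochastic gradients. At iteration $t\ge1$, worker $i$ observes $\mathbf{G}_i^t=\nabla F_i(\mathbf{x}_i^{t-1};\zeta_i^t)$, where the samples $\zeta_i^t\sim\mathcal{D}_i$ are independent across workers $i$ and iterations $t$. The stochastic gradients are unbiased: $\mathbb{E}[\mathbf{G}_i^t\mid\boldsymbol{\zeta}^{[t-1]}]=\nabla f_i(\mathbf{x}_i^{t-1})$, where $\boldsymbol{\zeta}^{[t-1]}$ denotes all samples $\zeta_j^\tau$ with $1\le j\le N$ and $1\le\tau\le t-1$. Assumptions. (1) Smoothness: each $f_i$ is differentiable and smooth with modulus $L>0$, i.e. $\Vert\nabla f_i(\mathbf{x})-\nabla f_i(\mathbf{y})\Vert\le L\Vert\mathbf{x}-\mathbf{y}\Vert$ for all $\mathbf{x},\mathbf{y}$. (2) There exist constants $\sigma>0$, $G>0$ such that for all $\mathbf{x}$ and all $i$: $\mathbb{E}_{\zeta_i\sim\mathcal{D}_i}\Vert\nabla F_i(\mathbf{x};\zeta_i)-\nabla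 f_i(\mathbf{x})\Vert^2\le\sigma^2$ and $\mathbb{E}_{\zeta_i\sim\mathcal{D}_i}\Vert\nabla F_i(\mathbf{x};\zeta_i)\Vert^2\le G^2$. Parallel Restarted SGD (PR-SGD). Input: learning rate $\gamma>0$, integer $I>0$, and a common deterministic initial point $\mathbf{x}_i^0=\overline{\mathbf{y}}\in\mathbb{R}^m$ for all $i$. For $t=1,\dots,T$: each worker $i$ observes $\mathbf{G}_i^t$ at the point $\mathbf{x}_i^{t-1}$; if $t$ is a multiple of $I$, compute $\overline{\mathbf{y}}=\frac1N\sum_{i=1}^N\mathbf{x}_i^{t-1}$ and set $\mathbf{x}_i^t=\overline{\mathbf{y}}-\gamma\mathbf{G}_i^t$ for all $i$; otherwise set $\mathbf{x}_i^t=\mathbf{x}_i^{t-1}-\gamma\mathbf{G}_i^t$ for all $i$. The constant in $O(\cdot)$ depends only on $L$, $G$, $\sigma$ and $f(\overline{\mathbf{x}}^0)-f^\ast$. *)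

(* Defs.v *)
From HB Require Import structures.
From mathcomp Require Import all_boot all_order all_algebra.
From mathcomp Require Import all_classical all_reals all_analysis.

Set Implicit Arguments.
Unset Strict Implicit.
Unset Printing Implicit Defensive.
Import Order.TTheory GRing.Theory Num.Theory.
Import numFieldNormedType.Exports.
Local Open Scope classical_set_scope.
Local Open Scope ring_scope.

(* The norm that the library puts on row vectors is the sup norm; it induces
   the same topology, hence the same differentiability. *)
Definition enorm (R : realType) (m : nat) (v : 'rV[R]_m) : R :=
  Num.sqrt (\sum_(j < m) v 0 j ^+ 2).

Definition gradient (R : realType) (m : nat) (f : 'rV[R]_m -> R)
    (x : 'rV[R]_m) : 'rV[R]_m :=
  \row_(j < m) 'D_(delta_mx 0 j) f x.

Definition mean (R : realType) (V : lmodType R) (N : nat) (v : 'I_N -> V) : V :=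
  N%:R^-1 *: \sum_(i < N) v i.

Definition is_minimum_value (R : realType) (T : Type) (f : T -> R) (c : R) :
    Prop :=
  (exists x, f x = c) /\ (forall x, c <= f x).

(* [fine] is harmless wherever F x is integrable. *)
Definition expected_loss (R : realType) (m : nat) (d : measure_display)
    (S : measurableType d) (D : probability S R) (F : 'rV[R]_m -> S -> R)
    (x : 'rV[R]_m) : R :=
  fine ('E_D[F x]).

Definition mean_loss (R : realType) (m N : nat) (d : 'I_N -> measure_display)
    (S : forall i, measurableType (d i)) (D : forall i, probability (S i) R)
    (F : forall i, 'rV[R]_m -> S i -> R) (x : 'rV[R]_m) : R :=
  N%:R^-1 * \sum_(i < N) expected_loss (D i) (F i) x.

(* The iterates along one realization z of the samples: [prsgd F gamma I y0 z t i]
   is x_i^t, and the sample z i t is used in the step from x_i^(t-1) to x_i^t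
   (so z i 0 is never used). At a restart the gradient is still taken at
   x_i^(t-1), not at the average. *)
Fixpoint prsgd (R : realType) (m N : nat) (S : 'I_N -> Type)
    (F : forall i, 'rV[R]_m -> S i -> R) (gamma : R) (I : nat)
    (y0 : 'rV[R]_m) (z : forall i, nat -> S i) (t : nat) (i : 'I_N) :
    'rV[R]_m :=
  if t is t'.+1 then
    let x := prsgd F gamma I y0 z t' in
    let g := gradient (fun y => F i y (z i t)) (x i) in
    (if (I %| t)%N then mean x else x i) - gamma *: g
  else y0.

Definition mutually_independent (d0 : measure_display)
    (Omega : measurableType d0) (R : realType) (P : probability Omega R)
    (K : choiceType) (J : set K) (d : K -> measure_display)
    (S : forall k, measurableType (d k)) (X : forall k, {RV P >-> S k}) :
    Prop :=
  forall s : seq K, uniq s -> [set` s] `<=` J ->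
  forall A : forall k, set (S k), (forall k, measurable (A k)) ->
    P (\bigcap_(k in [set` s]) (X k @^-1` A k)) =
    (\prod_(k <- s) P (X k @^-1` A k))%E.

(* The sigma-algebra generated by the samples zeta_j^tau, 1 <= tau <= t. *)
Definition history (d0 : measure_display) (Omega : measurableType d0)
    (N : nat) (d : 'I_N -> measure_display)
    (S : forall i, measurableType (d i))
    (zeta : forall i, nat -> {mfun Omega >-> S i}) (t : nat) : set (set Omega) :=
  <<s [set A | exists j tau B, [/\ (1 <= tau <= t)%N, measurable B
                              & A = zeta j tau @^-1` B]] >>.

(* Y is a version of the conditional expectation of X given the
   sub-sigma-algebra H. *)
Definition is_cond_expectation (d0 : measure_display)
    (Omega : measurableType d0) (R : realType) (P : probability Omega R)
    (H : set (set Omega)) (X Y : Omega -> R) : Prop :=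
  [/\ P.-integrable setT (EFin \o X),
      P.-integrable setT (EFin \o Y),
      (forall B : set R, measurable B -> H (Y @^-1` B)) &
      (forall A, H A -> \int[P]_(w in A) (Y w)%:E = \int[P]_(w in A) (X w)%:E)%E].

(* Main.v *)
Require Import Defs.
From HB Require Import structures.
From mathcomp Require Import all_boot all_order all_algebra.
From mathcomp Require Import all_classical all_reals all_analysis.
From mathcomp Require Import measurable_realfun ring lra.

Set Implicit Arguments.
Unset Strict Implicit.
Unset Printing Implicit Defensive.
Import Order.TTheory GRing.Theory Num.Theory.
Import numFieldNormedType.Exports.
Local Open Scope classical_set_scope.
Local Open Scope ring_scope.

(** Let x_i denote the iterates, xbar their average, g_i the stochastic
    gradients, h_i the exact gradients of the f_i at the x_i, and
    n_i = g_i - h_i the noises. The average obeys xbar' = xbar - gamma * mean g whether or not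
    the iteration restarts (xbar_next), so f(xbar) can be followed by the
    descent lemma for smooth functions. Completing a square and using
    gamma * L <= 1, which holds because N <= T, gives a pathwise inequality
    (descent_step)
      f(xbar') + gamma/2 |grad f(xbar)|^2
        <= f(xbar) + gamma L^2/2 * mean_i |xbar - x_i|^2
           + <b, mean n> + L gamma^2/2 |mean n|^2
    where b depends only on the past. In expectation,
    - the drift mean_i |xbar - x_i|^2 is at most (gamma I G)^2, because each
      worker has made at most I steps of L2 norm at most gamma G since the last
      point common to all workers (drift_mean);
    - the term <b, mean n> vanishes, and the noises of distinct workers are
      uncorrelated, so |mean n|^2 is at most sigma^2 / N (n_orthogonal,
      Ex_enorm_mean_n).
    Summing over the iterations telescopes f(xbar), which stays above its
    minimum; dividing by gamma T / 2 and inserting gamma gives the rate.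

    The probabilistic content is the freezing principle: if a sample is
    independent of a sigma-algebra, then a function of the sample and of
    quantities measurable for that sigma-algebra is integrated by first
    integrating the sample, the rest being frozen (ge0_freezing,
    cond_expectation_frozen). It transports the moment bounds from fixed points
    to the random iterates, and it extends unbiasedness, given conditionally on
    the past, to a conditioning that also includes the simultaneous samples of
    the other workers (integral_mul_cond_expectation). It requires gradients
    that are jointly measurable in the point and the sample. They are, because
    F is continuous in the point and measurable in the sample and a gradient is
    a limit of difference quotients (measurable_gradient). *)

(** * Joint measurability of functions and gradients *)

Lemma measurable_sum_real d (X : measurableType d) (R : realType) (I : Type)
    (s : seq I) (h : I -> X -> R) :
  (forall i, measurable_fun setT (h i)) ->
  measurable_fun setT (fun p => \sum_(i <- s) h i p).
Proof.
move=> mh; elim: s => [|i s IH].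
  by under eq_fun do rewrite big_nil; exact: measurable_cst.
by under eq_fun do rewrite big_cons; exact: measurable_funD.
Qed.

Section Caratheodory.
Context {d : measure_display} {X : measurableType d} {R : realType} {m : nat}.
Implicit Types (phi : 'rV[R]_m -> X -> R) (x : X -> 'rV[R]_m).

Let cell x (n : nat) (p : X) : 'rV[int]_m :=
  \row_j Num.floor (x p 0 j * n.+1%:R).
Let node (n : nat) (z : 'rV[int]_m) : 'rV[R]_m :=
  \row_j ((z 0 j)%:~R / n.+1%:R).

Let measurable_cell x n z :
  (forall j, measurable_fun setT (fun p => x p 0 j)) ->
  measurable [set p | cell x n p = z].
Proof.
move=> mx.
rewrite (_ : [set p | _] =
    \bigcap_(j in [set: 'I_m])
      [set p | ((z 0 j)%:~R <= x p 0 j * n.+1%:R) &&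
               (x p 0 j * n.+1%:R < (z 0 j + 1)%:~R)]).
  apply: fin_bigcap_measurable; first exact: finite_finset.
  move=> j _.
  have mxn : measurable_fun setT (fun p => x p 0 j * n.+1%:R).
    exact: measurable_funM.
  have := measurable_and
     (measurable_fun_ler (measurable_cst ((z 0 j)%:~R : R)) mxn)
     (measurable_fun_ltr mxn (measurable_cst ((z 0 j + 1)%:~R : R))).
  by move=> /(_ measurableT [set true] I); rewrite setTI preimage_true.
apply/seteqP; split => [p /= <- j _|p /= H].
  by rewrite /= mxE; exact: floor_itv.
apply/rowP => j; rewrite mxE; apply: Order.POrderTheory.le_anti.
have /= /andP[h1 h2] := H j I.
by rewrite floor_ge_int h1 andbT -ltzD1 floor_lt_int.
Qed.

Let node_cell_cvg x p : (fun n => node n (cell x n p)) @ \oo --> x p.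
Proof.
apply/cvgrPdist_le => /= e e0; near=> n.
rewrite /Num.Def.normr/= mx_normrE bigmax_le ?ltW// => -[i j] _ /=.
rewrite (ord1 i) !mxE.
have n0 : (0 : R) < n.+1%:R by rewrite ltr0n.
have /andP[h1 h2] := floor_itv (x p 0 j * n.+1%:R).
apply: (@le_trans _ _ (n.+1%:R^-1)); last first.
  apply/ltW; near: n; exact: (near_infty_natSinv_lt (PosNum e0)).
rewrite ger0_norm ?subr_ge0 ?ler_pdivrMr//.
rewrite lerBlDr -{1}[n.+1%:R^-1]mul1r -mulrDl ler_pdivlMr//.
by rewrite addrC intrD in h2 *; rewrite ltW.
Unshelve. all: by end_near. Qed.

(** A grid of mesh 1/n.+1 replaces x p by a value in a countable set, on each
    cell of which the map is measurable in p alone; the mesh then goes to 0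
    and continuity in the first argument gives the limit.  This avoids any
    measurable structure on the space of row vectors. *)
Lemma measurable_caratheodory phi x :
  (forall p, continuous (phi^~ p)) -> (forall y, measurable_fun setT (phi y)) ->
  (forall j, measurable_fun setT (fun p => x p 0 j)) ->
  measurable_fun setT (fun p => phi (x p) p).
Proof.
move=> cphi mphi mx.
apply: (@measurable_fun_cvg _ _ _ _ (fun n p => phi (node n (cell x n p)) p)).
  move=> n _ B mB; rewrite setTI.
  rewrite [X in measurable X](_ : _ = \bigcup_(z in [set: 'rV[int]_m])
    ([set p | cell x n p = z] `&` (phi (node n z) @^-1` B))).
    apply: countable_bigcupT_measurable => // z; apply: measurableI.
      exact: measurable_cell.
    by rewrite -[X in measurable X]setTI; exact: mphi.
  apply/seteqP; split => [p /= Bp|p [z _] [/= <-]//].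
  by exists (cell x n p).
move=> p _; apply: (@cvg_comp _ _ _ (fun n => node n (cell x n p)) (phi^~ p)).
  exact: node_cell_cvg.
exact: cphi.
Qed.

(** A partial derivative is the limit of the difference quotients with steps
    1/n.+1, each of which is measurable by the preceding lemma. *)
Lemma measurable_gradient phi x :
  (forall p y, differentiable (phi^~ p) y) ->
  (forall y, measurable_fun setT (phi y)) ->
  (forall j, measurable_fun setT (fun p => x p 0 j)) ->
  forall j, measurable_fun setT (fun p => gradient (phi^~ p) (x p) 0 j).
Proof.
move=> dphi mphi mx j.
have cphi p : continuous (phi^~ p).
  by move=> y; exact: differentiable_continuous.
pose h n : R := n.+1%:R^-1.
apply: (@measurable_fun_cvg _ _ _ _ (fun n p =>
  (h n)^-1 * (phi (h n *: delta_mx 0 j + x p) p - phi (x p) p))).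
  move=> n; apply: measurable_funM => //; apply: measurable_funB.
    apply: measurable_caratheodory => // k.
    under eq_fun do rewrite mxE.
    by apply: measurable_funD.
  exact: measurable_caratheodory.
move=> p _; rewrite mxE.
have : derivable (phi^~ p) (x p) (delta_mx 0 j) by exact: diff_derivable.
move=> /cvg_ex [l hl].
rewrite /derive (cvg_lim _ hl)//.
apply: (@cvg_comp _ _ _ h (fun t => t^-1 *:
  (phi (t *: delta_mx 0 j + x p) p - phi (x p) p)) _ (0^')); last by apply: hl.
move=> A; rewrite /dnbhs /within/= => A0.
have : \forall n \near \oo, (h n != 0 -> A (h n)) by exact: cvg_harmonic A0.
by apply: filterS => n; apply; rewrite invr_neq0 ?pnatr_eq0.
Qed.
End Caratheodory.

(** * Independence of one sample from a family of others *)

Definition generators (T : Type) (K : Type) (J : set K)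
    (d : K -> measure_display) (S : forall k, measurableType (d k))
    (X : forall k, T -> S k) : set (set T) :=
  [set A | exists k B, [/\ J k, measurable B & A = X k @^-1` B]].

Section independence.
Context {d0 : measure_display} {Omega : measurableType d0} {R : realType}.
Context {P : probability Omega R} {K : choiceType} {d : K -> measure_display}.
Context {S : forall k, measurableType (d k)} {X : forall k, {RV P >-> S k}}.

Lemma generators_measurable (J : set K) :
  generators J (fun k => X k : Omega -> S k) `<=` measurable.
Proof.
move=> _ [k [B [_ mB ->]]].
by rewrite -[X in measurable X]setTI; exact: measurable_funP.
Qed.

(** Mutual independence is a product rule for finite intersections of
    preimages. Those with indices in J form a pi-system generating the left
    sigma-algebra; for a fixed B, both sides are finite measures in A which
    agree on it, hence everywhere. *)
Lemma mutually_independent_rest (I J : set K) (k0 : K) :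
  mutually_independent (P := P) I X -> J `<=` I -> I k0 -> ~ J k0 ->
  forall A B, <<s generators J (fun k => X k : Omega -> S k) >> A ->
    measurable B ->
    P (A `&` X k0 @^-1` B) = (P A * P (X k0 @^-1` B))%E.
Proof.
move=> indX JI Ik0 nJk0 A B HA mB.
pose box (s : seq K) (C : forall k, set (S k)) : set Omega :=
  \bigcap_(k in [set` s]) (X k @^-1` C k).
pose G : set (set Omega) := [set A | exists s (C : forall k, set (S k)),
  [/\ uniq s, [set` s] `<=` J, (forall k, measurable (C k)) & A = box s C]].
have mX k (C : set (S k)) : measurable C -> measurable (X k @^-1` C).
  by move=> mC; rewrite -[X in measurable X]setTI; exact: measurable_funP.
have mbox s C : (forall k, measurable (C k)) -> measurable (box s C).
  by move=> mC; apply: fin_bigcap_measurable => // k _; exact: mX.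
have mB0 := mX _ _ mB.
set B0 := X k0 @^-1` B in mB0 *.
have fB : P B0 \is a fin_num by exact: fin_num_measure.
have fB0 : (0 <= fine (P B0))%R by exact: fine_ge0.
pose m1 := mrestr P mB0.
pose m2 := mscale (NngNum fB0) P.
suff : m1 A = m2 A.
  rewrite /m1 /m2 /mrestr /mscale /= => ->.
  by rewrite fineK// muleC.
apply: (g_sigma_algebra_measure_unique G _ (fun=> setT)) => //.
- by move=> _ [s [C [us sJ mC ->]]]; exact: mbox.
- move=> _; exists [::], (fun=> setT); split => //.
  by apply/seteqP; split.
- by rewrite bigcup_const//; exists 0%N.
- move=> _ _ [s1 [C1 [us1 s1J mC1 ->]]] [s2 [C2 [us2 s2J mC2 ->]]].
  (* outside its own index list a box imposes no condition *)
  exists (undup (s1 ++ s2)), (fun k =>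
    (if k \in s1 then C1 k else setT) `&` (if k \in s2 then C2 k else setT)).
  split; first exact: undup_uniq.
  + by move=> k /=; rewrite mem_undup mem_cat => /orP[/s1J|/s2J].
  + by move=> k; apply: measurableI; case: ifP.
  + apply/seteqP; split => w.
      move=> [h1 h2] k /= ks; split; case: ifPn => //= ks'; first exact: h1.
      exact: h2.
    move=> h; split => k /= ks.
      have [] := h k; first by rewrite /= mem_undup mem_cat ks.
      by rewrite ks.
    have [] := h k; first by rewrite /= mem_undup mem_cat ks orbT.
    by rewrite ks.
- move=> _ [s [C [us sJ mC ->]]].
  have nk0 : k0 \notin s by apply/negP => /sJ.
  have eqC k : k \in s -> dfwith C k0 B k = C k.
    by move=> ks; rewrite dfwithout//; apply: contraNneq nk0 => ->.
  rewrite /m1 /m2 /mrestr /mscale /=.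
  transitivity (P (box (k0 :: s) (dfwith C k0 B))).
    congr (P _); apply/seteqP; split => w.
      move=> [h1 h2] k /=; rewrite inE => /predU1P[->|ks].
        by rewrite dfwithin.
      by rewrite eqC//; exact: h1.
    move=> h; split => [k /= ks|].
      by have := h k; rewrite /= eqC// inE ks orbT => /(_ isT).
    by have := h k0; rewrite /= dfwithin mem_head => /(_ isT).
  have mD k : measurable (dfwith C k0 B k) by case: dfwithP.
  rewrite indX//=; last 2 first.
  + by rewrite nk0.
  + by move=> k /=; rewrite inE => /predU1P[->//|/sJ/JI].
  rewrite /mscale/= big_cons dfwithin fineK//; congr (_ * _)%E.
  rewrite [RHS]indX//; last by move=> k /sJ/JI.
  by apply: eq_big_seq => k ks; rewrite eqC.
- move=> _; rewrite /= /mrestr setTI.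
  by rewrite (le_lt_trans (probability_le1 _ _))// ltry.
- apply: sub_sigma_algebra2 HA => _ [k [C [Jk mC ->]]].
  exists [:: k], (dfwith (fun k => setT : set (S k)) k C); split => //.
  + by move=> k1 /=; rewrite inE => /eqP ->.
  + by move=> k1; case: dfwithP.
  + apply/seteqP; split => w.
      by move=> h k1 /=; rewrite inE => /eqP ->; rewrite dfwithin.
    by move=> /(_ k); rewrite /= dfwithin mem_head => /(_ isT).
Qed.

End independence.

(** * Freezing: integrating an independent sample first *)

Section freezing.
Local Open Scope ereal_scope.
Context {d0 d1 : measure_display} {Omega : measurableType d0}
  {S : measurableType d1} {R : realType}.
Variables (P : probability Omega R) (D : probability S R) (zeta : {RV P >-> S}).
Hypothesis zetaD : forall B, measurable B -> P (zeta @^-1` B) = D B.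

Definition independent_of (gen : set (set Omega)) :=
  forall A B, <<s gen >> A -> measurable B ->
    P (A `&` zeta @^-1` B) = P A * P (zeta @^-1` B).

Section one_algebra.
Variable gen : set (set Omega).
Hypothesis mgen : gen `<=` measurable.
Hypothesis indep : independent_of gen.
Let H := g_sigma_algebraType gen.

(* the identity, read as a map to the coarser measurable space *)
Let forget (w : Omega) : H := w.

Lemma measurable_forget : measurable_fun setT forget.
Proof.
move=> _ A mA; rewrite setTI.
apply: (smallest_sub _ mgen mA); exact: sigma_algebra_measurable.
Qed.

HB.instance Definition _ :=
  isMeasurableFun.Build _ _ _ _ forget measurable_forget.

Let PH : probability H R := distribution P forget.

Let joint (w : Omega) : H * S := (forget w, zeta w).

Let measurable_joint : measurable_fun setT joint.
Proof. by apply: measurable_fun_pair => //; exact: measurable_forget. Qed.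

Let joint_distribution A : measurable A -> (PH \x D) A = pushforward P joint A.
Proof.
move=> mA.
apply: (@product_measure_unique _ _ _ _ _ _ _ (pushforward P joint)) => //.
by move=> B C mB mC; rewrite /pushforward [RHS]/= -zetaD// -indep.
Qed.

(** By independence the pair (w, zeta w) has the product law, and
    Fubini-Tonelli integrates the fresh sample first, with w frozen. *)
Lemma ge0_freezing (h : H * S -> \bar R) : measurable_fun setT h ->
  (forall z, 0 <= h z) ->
  \int[P]_w h (w, zeta w) = \int[P]_w \int[D]_s h (w, s).
Proof.
move=> mh h0.
transitivity (\int[pushforward P joint]_z h z).
  by rewrite ge0_integral_pushforward.
rewrite (eq_measure_integral (PH \x D)); last first.
  by move=> A mA _; apply/esym; exact: joint_distribution.
rewrite fubini_tonelli1// ge0_integral_pushforward//.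
  exact: measurable_fun_fubini_tonelli_F.
by move=> w _; exact: integral_ge0.
Qed.


Lemma freezing_bound (h : H * S -> \bar R) (c : R) : measurable_fun setT h ->
  (forall z, 0 <= h z) -> (forall w, \int[D]_s h (w, s) <= c%:E) ->
  \int[P]_w h (w, zeta w) <= c%:E.
Proof.
move=> mh h0 hc; rewrite ge0_freezing//.
have <- : \int[P]_w (cst c%:E w) = c%:E.
  transitivity (c%:E * P setT); first by rewrite integral_cst.
  by rewrite probability_setT mule1.
have c0 : 0 <= c%:E by apply: le_trans (hc point); exact: integral_ge0.
apply: ge0_le_integral => //.
- by move=> w _; exact: integral_ge0.
  have mF := @measurable_fun_fubini_tonelli_F _ _ _ _ R D h mh h0.
  exact: (measurableT_comp mF measurable_forget).
Qed.

Section integrable.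
Variable h : H * S -> \bar R.
Hypothesis mh : measurable_fun setT h.
Hypothesis ih : P.-integrable setT (fun w => h (w, zeta w)).

Let prod_integrable : (PH \x D).-integrable setT h.
Proof.
apply/integrableP; split => //.
rewrite (eq_measure_integral (pushforward P joint)); last first.
  by move=> A mA _; exact: joint_distribution.
rewrite ge0_integral_pushforward//; last exact: measurableT_comp.
by move/integrableP: ih => [].
Qed.

Lemma freezing_measurable :
  measurable_fun setT ((fun w => \int[D]_s h (w, s)) : H -> \bar R).
Proof. exact: (measurable_fubini_F prod_integrable). Qed.

Lemma freezing_integrable :
  PH.-integrable setT ((fun w => \int[D]_s h (w, s)) : H -> \bar R).
Proof. exact: (integrable_fubini_F prod_integrable). Qed.

Lemma freezing_ae_integrable :
  {ae PH, forall w, D.-integrable setT (fun s => h (w, s))}.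
Proof. exact: (ae_integrable1 prod_integrable). Qed.

Lemma freezing :
  \int[P]_w h (w, zeta w) = \int[PH]_w \int[D]_s h (w, s).
Proof.
transitivity (\int[pushforward P joint]_z h z).
  by rewrite integral_pushforward.
rewrite (eq_measure_integral (PH \x D)); last first.
  by move=> A mA _; apply/esym; exact: joint_distribution.
by rewrite -integral12_prod_meas1.
Qed.

Lemma freezingP : \int[P]_w h (w, zeta w) = \int[P]_w \int[D]_s h (w, s).
Proof.
rewrite freezing integral_pushforward//; first exact: freezing_measurable.
move/integrableP: freezing_integrable => [_ iH]; apply/integrableP; split.
  apply: (measurableT_comp freezing_measurable).
  exact: measurable_forget.
apply: le_lt_trans iH; rewrite ge0_integral_pushforward//.
by apply: measurableT_comp => //; exact: freezing_measurable.
Qed.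

End integrable.
Local Close Scope ereal_scope.

(** Conditional expectations given in terms of versions are identified with
    the frozen integral: both sides have the same integral over every event of
    the sigma-algebra. This gives the pointwise (almost sure) meaning to the
    unbiasedness of a sampled function. *)
Lemma cond_expectation_frozen (g : H * S -> R) (c : Omega -> R) :
  measurable_fun setT g ->
  is_cond_expectation P <<s gen >> (fun w => g (w, zeta w)) c ->
  {ae P, forall w, D.-integrable setT (fun s => (g (w, s))%:E) /\
                   (\int[D]_s (g (w, s))%:E = (c w)%:E)%E}.
Proof.
move=> mg [ig ic Hc cE].
have mgE : measurable_fun setT (EFin \o g) by exact/measurable_EFinP.
have mc : measurable_fun setT (c : H -> R).
  by move=> _ B mB; rewrite setTI; exact: Hc.
have transfer (Q : Omega -> Prop) :
    {ae PH, forall w : H, Q w} -> {ae P, forall w, Q w}.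
  move=> [N [mN PN QN]]; exists N; split => //.
  by have := measurable_forget measurableT mN; rewrite setTI.
have eqc : ae_eq PH setT (fun w => \int[D]_s (g (w, s))%:E)%E (EFin \o c).
  apply: integral_ae_eq => //.
  - exact: (freezing_integrable mgE ig).
  - exact/measurable_EFinP.
  move=> E _ mE.
  have mEO : measurable (E : set Omega).
    by have := measurable_forget measurableT mE; rewrite setTI.
  pose h (z : H * S) := (\1_E z.1 * g z)%R.
  have mh : measurable_fun setT h.
    by apply: measurable_funM => //; apply: measurableT_comp.
  transitivity (\int[P]_(w in E) (c w)%:E)%E; last first.
    rewrite integral_pushforward//=.
      exact/measurable_EFinP.
    by apply: (integrableS measurableT).
  rewrite cE//.
  transitivity (\int[P]_w (h (w, zeta w))%:E)%E.
    rewrite (@freezing (EFin \o h))//=.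
    + rewrite [LHS]integral_mkcond; apply: eq_integral => w _.
      rewrite patchE; case: ifPn => wE.
        by apply: eq_integral => s _; rewrite /h indicE/= wE mul1r.
      rewrite integral0_eq// => s _.
      by rewrite /h indicE/= (negbTE wE) mul0r.
    + exact/measurable_EFinP.
    + apply: (le_integrable measurableT _ _ ig) => //.
        apply/measurable_EFinP.
        apply: measurable_funM; first exact: measurable_indic.
        by apply/measurable_EFinP; exact: measurable_int ig.
      move=> w _; rewrite /h /= lee_fin normrM indicE.
      by case: (w \in E); rewrite ?normr1 ?normr0 ?mul1r ?mul0r.
  rewrite [RHS]integral_mkcond; apply: eq_integral => w _.
  rewrite patchE /h indicE/=; case: ifPn => wE; first by rewrite mul1r.
  by rewrite mul0r.
have iD := freezing_ae_integrable mgE ig.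
move: (transfer _ iD) (transfer _ eqc).
apply: (@filterS2 _ _ (ae_filter_ringOfSetsType P)) => w /= h1 h2.
by split => //; exact: h2.
Qed.
End one_algebra.

Local Close Scope ereal_scope.

(** Conditioning on gen1 may be replaced by conditioning on any larger gen2
    that is still independent of zeta: the frozen integral depends only on
    the law of zeta. This is what allows u to depend on other samples drawn
    at the same time as zeta. *)
Lemma integral_mul_cond_expectation (gen1 gen2 : set (set Omega))
    (g : g_sigma_algebraType gen1 * S -> R) (c u : Omega -> R) :
  gen2 `<=` measurable -> gen1 `<=` gen2 -> independent_of gen2 ->
  measurable_fun setT g ->
  is_cond_expectation P <<s gen1 >> (fun w => g (w, zeta w)) c ->
  measurable_fun setT (u : g_sigma_algebraType gen2 -> R) ->
  P.-integrable setT (fun w => (u w * g (w, zeta w))%:E) ->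
  (\int[P]_w (u w * g (w, zeta w))%:E = \int[P]_w (u w * c w)%:E)%E.
Proof.
move=> mgen2 gen12 ind2 mg condc mu iug.
have mgen1 : gen1 `<=` measurable by move=> A /gen12/mgen2.
have ind1 : independent_of gen1.
  by move=> A B HA mB; apply: ind2 => //; exact: sub_sigma_algebra2 HA.
have gsc := cond_expectation_frozen mgen1 ind1 mg condc.
have mu' : measurable_fun setT u.
  exact: (measurableT_comp mu (measurable_forget mgen2)).
pose h (z : g_sigma_algebraType gen2 * S) : R := u z.1 * g (z.1, z.2).
have mh : measurable_fun setT h.
  apply: measurable_funM; first exact: measurableT_comp.
  apply: (measurableT_comp mg); apply: measurable_fun_pair => //.
  have m21 : measurable_fun setT
      ((fun w => w) : g_sigma_algebraType gen2 -> g_sigma_algebraType gen1).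
    move=> _ A mA; rewrite setTI.
    have := @sub_sigma_algebra2 Omega setT gen2 gen1 gen12 A mA.
    exact.
  exact: (measurableT_comp m21 measurable_fst).
have mhE : measurable_fun setT (EFin \o h) by exact/measurable_EFinP.
have := freezingP mgen2 ind2 mhE iug.
rewrite /= => ->; apply: ae_eq_integral => //.
- exact: (measurableT_comp (freezing_measurable mgen2 ind2 mhE iug)
    (measurable_forget mgen2)).
- case: condc => _ /measurable_int/measurable_EFinP mc _ _.
  by apply/measurable_EFinP/measurable_funM.
move: gsc; apply: (@filterS _ _ (ae_filter_ringOfSetsType P)) => w /= [iD cE] _.
rewrite /h /= EFinM -cE -integralZl//.
Qed.

End freezing.

(** * Euclidean geometry of row vectors *)

Section Euclidean.
Context {R : realType} {m : nat}.
Implicit Types u v : 'rV[R]_m.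

Definition dotv u v : R := \sum_(j < m) u 0 j * v 0 j.

Lemma enormE u : enorm u ^+ 2 = dotv u u.
Proof.
rewrite /enorm sqr_sqrtr; first by apply: eq_bigr => j _; rewrite expr2.
by apply: sumr_ge0 => j _; exact: sqr_ge0.
Qed.

Lemma enorm_ge0 u : 0 <= enorm u. Proof. exact: sqrtr_ge0. Qed.

Lemma dotvv_ge0 u : 0 <= dotv u u.
Proof. by rewrite -enormE sqr_ge0. Qed.

Lemma dotvC u v : dotv u v = dotv v u.
Proof. by apply: eq_bigr => j _; rewrite mulrC. Qed.

Lemma dotvDl u1 u2 v : dotv (u1 + u2) v = dotv u1 v + dotv u2 v.
Proof. by rewrite -big_split; apply: eq_bigr => j _; rewrite mxE mulrDl. Qed.

Lemma dotvZl a u v : dotv (a *: u) v = a * dotv u v.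
Proof. by rewrite mulr_sumr; apply: eq_bigr => j _; rewrite mxE mulrA. Qed.

Lemma dotvNl u v : dotv (- u) v = - dotv u v.
Proof. by rewrite -scaleN1r dotvZl mulN1r. Qed.

Lemma dotvDr u v1 v2 : dotv u (v1 + v2) = dotv u v1 + dotv u v2.
Proof. by rewrite dotvC dotvDl !(dotvC u). Qed.

Lemma dotvZr a u v : dotv u (a *: v) = a * dotv u v.
Proof. by rewrite dotvC dotvZl dotvC. Qed.

Lemma dotvNr u v : dotv u (- v) = - dotv u v.
Proof. by rewrite dotvC dotvNl dotvC. Qed.

Definition dotvE := (dotvDl, dotvDr, dotvNl, dotvNr, dotvZl, dotvZr).

Lemma dotv_sumr (I : finType) u (v : I -> 'rV[R]_m) :
  dotv u (\sum_i v i) = \sum_i dotv u (v i).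
Proof.
rewrite exchange_big; apply: eq_bigr => j _.
by rewrite summxE mulr_sumr.
Qed.

Lemma dotv_enorm0 u v : enorm u = 0 -> dotv u v = 0.
Proof.
move=> u0; have : dotv u u = 0 by rewrite -enormE u0 expr0n.
move=> /eqP; rewrite psumr_eq0 => [/allP h|j _].
  rewrite /dotv big1// => j _; have := h j (mem_index_enum _).
  by rewrite mulf_eq0 orbb => /eqP ->; rewrite mul0r.
by rewrite -expr2 sqr_ge0.
Qed.

Lemma dotv_le_enorm u v : dotv u v <= enorm u * enorm v.
Proof.
have [u0|u0] := eqVneq (enorm u) 0; first by rewrite dotv_enorm0// u0 mul0r.
have [v0|v0] := eqVneq (enorm v) 0.
  by rewrite dotvC dotv_enorm0// v0 mulr0.
have up : 0 < enorm u by rewrite lt_def u0 enorm_ge0.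
have vp : 0 < enorm v by rewrite lt_def v0 enorm_ge0.
have := dotvv_ge0 (enorm v *: u - enorm u *: v).
rewrite !dotvE (dotvC v u) -!enormE.
have := mulr_gt0 up vp.
move: (dotv u v) (enorm u) (enorm v) => c a b ab h.
have : 0 <= (a * b) * (a * b - c) by nra.
by rewrite pmulr_rge0// subr_ge0.
Qed.

Lemma mean_sumE (N : nat) (v : 'I_N -> 'rV[R]_m) :
  (0 < N)%N -> \sum_i v i = N%:R *: mean v.
Proof.
by move=> N0; rewrite /mean scalerA divff ?scale1r// pnatr_eq0 -lt0n.
Qed.

Lemma sum_const_ord N (c : R) : \sum_(i < N) c = N%:R * c.
Proof. by rewrite sumr_const card_ord mulr_natl. Qed.

(** Huygens: the mean minimizes the sum of squared distances, so the workers
    may be compared with any common point instead of their average. *)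
Lemma sum_dist_mean_le (N : nat) (v : 'I_N -> 'rV[R]_m) c : (0 < N)%N ->
  \sum_i enorm (mean v - v i) ^+ 2 <= \sum_i enorm (v i - c) ^+ 2.
Proof.
move=> N0; move: (mean v) (mean_sumE v N0) => M vM.
have -> : \sum_i enorm (v i - c) ^+ 2 =
    \sum_i enorm (M - v i) ^+ 2 + N%:R * enorm (M - c) ^+ 2.
  have h i : enorm (v i - c) ^+ 2 = enorm (M - v i) ^+ 2
     + (2 * dotv (M - c) (v i) - 2 * dotv (M - c) M + enorm (M - c) ^+ 2).
    rewrite !enormE !dotvE (dotvC (v i) c) (dotvC (v i) M) (dotvC c M).
    ring.
  under eq_bigr do rewrite h.
  rewrite big_split /= 2!big_split /= -mulr_sumr -dotv_sumr vM dotvZr.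
  rewrite !sum_const_ord; ring.
by rewrite lerDl mulr_ge0// sqr_ge0.
Qed.

Lemma enorm_mean_le (N : nat) (v : 'I_N -> 'rV[R]_m) : (0 < N)%N ->
  enorm (mean v) ^+ 2 <= N%:R^-1 * \sum_i enorm (v i) ^+ 2.
Proof.
move=> N0; have Np : (0 : R) < N%:R by rewrite ltr0n.
move: (mean v) (mean_sumE v N0) => M vM.
have : 0 <= \sum_i enorm (M - v i) ^+ 2.
  by apply: sumr_ge0 => i _; exact: sqr_ge0.
have h i : enorm (M - v i) ^+ 2 =
   enorm (v i) ^+ 2 + (enorm M ^+ 2 - 2 * dotv M (v i)).
  rewrite !enormE !dotvE (dotvC (v i) M); ring.
under eq_bigr do rewrite h.
rewrite big_split /= big_split /= sum_const_ord sumrN -mulr_sumr.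
rewrite -dotv_sumr vM dotvZr -enormE ler_pdivlMl//.
move: (enorm M ^+ 2) (\sum_i _) => a b. lra.
Qed.

Lemma coord_le_enorm u j : u 0 j ^+ 2 <= enorm u ^+ 2.
Proof.
rewrite enormE /dotv (bigD1 j)//= -expr2 lerDl.
by apply: sumr_ge0 => k _; rewrite -expr2 sqr_ge0.
Qed.

(** Young's inequality, with weights such that iterating it from k to k + 1
    steps of size at most 1 gives exactly (k + 1)^2. *)
Lemma enormB_young u v (k : R) : 0 < k ->
  enorm (u - v) ^+ 2 <= (1 + k^-1) * enorm u ^+ 2 + (1 + k) * enorm v ^+ 2.
Proof.
move=> k0; have := dotvv_ge0 (u + k *: v).
rewrite !enormE !dotvE (dotvC v u).
move: (dotv u u) (dotv u v) (dotv v v) => a b c h.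
rewrite -subr_ge0 (_ : _ - _ = k^-1 * (a + k * b + (k * b + k * (k * c)))).
  by rewrite mulr_ge0 ?invr_ge0 ?(ltW k0)//; lra.
by field; rewrite gt_eqF.
Qed.

Lemma enormZ2 a u : enorm (a *: u) ^+ 2 = a ^+ 2 * enorm u ^+ 2.
Proof. by rewrite !enormE dotvZl dotvZr mulrA expr2. Qed.

Lemma enormN2 u : enorm (- u) ^+ 2 = enorm u ^+ 2.
Proof. by rewrite -scaleN1r enormZ2 sqrrN expr1n mul1r. Qed.

End Euclidean.

(** * Descent for smooth functions *)

Section Smooth.
Context {R : realType} {m : nat}.
Implicit Types (f : 'rV[R]_m -> R) (u v x y : 'rV[R]_m).

Lemma derive_dotv f u v : differentiable f u ->
  'D_v f u = dotv (gradient f u) v.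
Proof.
move=> df; rewrite deriveE//.
rewrite [in LHS](row_sum_delta v) linear_sum; apply: eq_bigr => j _.
by rewrite linearZ /= mxE deriveE// mulrC.
Qed.

Lemma is_derive_line f x v (t : R) : differentiable f (x + t *: v) ->
  is_derive t 1 (fun s : R => f (x + s *: v))
    (dotv (gradient f (x + t *: v)) v).
Proof.
move=> df; have dv : derivable f (x + t *: v) v by exact: diff_derivable.
have Q : (fun h : R => h^-1 *: (((fun s : R => f (x + s *: v)) \o shift t)
            (h *: (1 : R^o)) - f (x + t *: v))) =
   (fun h => h^-1 *: ((f \o shift (x + t *: v)) (h *: v) - f (x + t *: v))).
  apply/funext => h /=; congr (_ *: (f _ - _)).
  rewrite /shift /= scalerDl [h *: 1]mulr1. by rewrite addrCA.
split; first by rewrite /derivable Q.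
by rewrite /derive Q -derive_dotv.
Qed.

(** Along the segment from x to y, the difference between f and the quadratic
    upper model has a nonpositive derivative, by Cauchy-Schwarz and the
    Lipschitz bound on the gradient. *)
Lemma descent_lemma f (L : R) x y :
  (forall u, differentiable f u) ->
  (forall u v, enorm (gradient f u - gradient f v) <= L * enorm (u - v)) ->
  f y <= f x + dotv (gradient f x) (y - x) + L / 2 * enorm (y - x) ^+ 2.
Proof.
move=> df Lf; set v := y - x; set a := dotv (gradient f x) v.
pose b := enorm v ^+ 2.
pose phi (t : R) := f (x + t *: v) - (t * a + L / 2 * b * t ^+ 2).
pose dphi (t : R) := dotv (gradient f (x + t *: v)) v - (a + L * b * t).
have dphiP (t : R) : is_derive t (1 : R) phi (dphi t).
  apply: is_deriveB; first exact: is_derive_line.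
  have h1 : is_derive t (1 : R) (a \*: (id : R -> R)) (a *: (1 : R)).
    exact: is_deriveZ.
  have h2 : is_derive t (1 : R) (L / 2 * b \*: ((id : R -> R) * (id : R -> R)))
      ((L / 2 * b) *: (t *: (1 : R) + t *: (1 : R))).
    by apply: is_deriveZ; exact: is_deriveM.
  have -> : (fun s : R => s * a + L / 2 * b * s ^+ 2) =
      (a \*: (id : R -> R)) + (L / 2 * b \*: ((id : R -> R) * (id : R -> R))).
    by apply/funext => s; rewrite fctE /= [in LHS]mulrC expr2.
  apply: (is_derive_eq (is_deriveD h1 h2)).
  rewrite /GRing.scale /=; lra.
have [|c c01 E] := @MVT R phi dphi 0 1 ltr01 (fun t _ => dphiP t).
  apply: derivable_within_continuous => t _; exact: ex_derive.
have c0 : 0 <= c by move: c01; rewrite in_itv /= => /andP[/ltW].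
have : dphi c <= 0.
  rewrite /dphi subr_le0 -lerBlDl -dotvNl -dotvDl.
  apply: (le_trans (dotv_le_enorm _ _)).
  have := Lf (x + c *: v) x; rewrite addrAC subrr add0r => h.
  apply: (le_trans (ler_wpM2r (enorm_ge0 v) h)).
  suff -> : enorm (c *: v) = c * enorm v by rewrite /b; lra.
  apply: (@mulfI _ 1); rewrite ?oner_eq0// !mul1r.
  apply/eqP; rewrite -(@eqrXn2 _ 2)// ?enorm_ge0 ?mulr_ge0 ?enorm_ge0//.
  by rewrite exprMn !enormE dotvZl dotvZr mulrA expr2.
move: E; rewrite subr0 mulr1 => <-; rewrite subr_le0 /phi scale1r scale0r addr0.
rewrite mul1r mul0r expr0n expr1n /= !(mulr0,addr0,subr0,mulr1).
by rewrite /v addrCA subrr addr0 -/v -/b; lra.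
Qed.


Context {N : nat}.
Variable f_ : 'I_N -> 'rV[R]_m -> R.
Let f x := N%:R^-1 * \sum_(i < N) f_ i x.
Variable L : R.
Hypothesis N_gt0 : (0 < N)%N.
Hypothesis df_ : forall i u, differentiable (f_ i) u.
Hypothesis lip_ : forall i u v,
  enorm (gradient (f_ i) u - gradient (f_ i) v) <= L * enorm (u - v).

Let fE : f = N%:R^-1 \*: (\sum_(i < N) f_ i).
Proof. by apply/funext => x; rewrite /f /= fct_sumE. Qed.

Lemma differentiable_mean_fun u : differentiable f u.
Proof.
rewrite fE; apply: differentiableZ.
by apply: differentiable_sum => i; exact: df_.
Qed.

Lemma gradient_mean_fun u : gradient f u = mean (fun i => gradient (f_ i) u).
Proof.
apply/rowP => j; rewrite mxE /mean mxE summxE fE deriveZ; last first.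
  by apply: derivable_sum => i; exact: diff_derivable.
rewrite derive_sum; last by move=> i; exact: diff_derivable.
by congr (_ * _); apply: eq_bigr => i _; rewrite mxE.
Qed.

Lemma meanB (v w : 'I_N -> 'rV[R]_m) :
  mean v - mean w = mean (fun i => v i - w i).
Proof. by rewrite /mean -scalerBr sumrB. Qed.

Lemma le_mean_const (a : 'I_N -> R) c :
  (forall i, a i <= c) -> N%:R^-1 * (\sum_(i < N) a i) <= c.
Proof.
move=> ac; rewrite ler_pdivrMl ?ltr0n//.
apply: (le_trans (ler_sum _ (fun i _ => ac i))).
by rewrite sumr_const card_ord mulr_natl.
Qed.

Lemma lipschitz_gradient_mean_fun u v : 0 <= L ->
  enorm (gradient f u - gradient f v) <= L * enorm (u - v).
Proof.
move=> L0.
rewrite -(@ler_pXn2r _ 2)// ?nnegrE ?enorm_ge0 ?mulr_ge0 ?enorm_ge0//.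
rewrite !gradient_mean_fun meanB (le_trans (enorm_mean_le _ N_gt0))//.
apply: le_mean_const => i.
by rewrite ler_pXn2r// ?nnegrE ?enorm_ge0 ?mulr_ge0 ?enorm_ge0.
Qed.

(** The descent lemma with g = h + noise. The cross term
    - gamma <grad f, mean h> is completed to a square, which leaves
    - gamma/2 |grad f|^2, the drift term |grad f - mean h|^2 bounded by
    smoothness, and - gamma/2 |mean h|^2; the last one absorbs the quadratic
    term L gamma^2 / 2 |mean h|^2 because gamma * L <= 1. The noise n survives
    only in a linear term, which has mean zero, and in its squared norm. *)
Lemma descent_step (x g : 'I_N -> 'rV[R]_m) (gamma : R) :
  let xbar := mean x in let h i := gradient (f_ i) (x i) in
  let n := mean (fun i => g i - h i) in
  0 <= L -> 0 <= gamma -> gamma * L <= 1 ->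
  f (xbar - gamma *: mean g) + gamma / 2 * enorm (gradient f xbar) ^+ 2 <=
  f xbar + gamma * L ^+ 2 / 2 * (N%:R^-1 * \sum_i enorm (xbar - x i) ^+ 2)
  + dotv ((L * gamma ^+ 2) *: mean h - gamma *: gradient f xbar) n
  + L * gamma ^+ 2 / 2 * enorm n ^+ 2.
Proof.
move=> xbar h n L0 g0 gL.
have := descent_lemma xbar (xbar - gamma *: mean g) differentiable_mean_fun
  (fun u v => lipschitz_gradient_mean_fun u v L0).
rewrite [xbar - _ - xbar]addrAC subrr add0r.
have -> : mean g = mean h + n by rewrite /n -meanB addrC subrK.
have : enorm (gradient f xbar - mean h) ^+ 2 <=
    L ^+ 2 * (N%:R^-1 * \sum_i enorm (xbar - x i) ^+ 2).
  rewrite gradient_mean_fun meanB (le_trans (enorm_mean_le _ N_gt0))//.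
  rewrite mulrCA ler_wpM2l ?invr_ge0// mulr_sumr ler_sum// => i _.
  rewrite -exprMn ler_pXn2r ?nnegrE ?mulr_ge0 ?enorm_ge0//; exact: lip_.
move: (N%:R^-1 * _) n (mean h) (gradient f xbar) => S n hb a.
move: (f xbar) (f _) => f0 f1; clear -L0 g0 gL.
rewrite !enormE !dotvE (dotvC hb a) (dotvC n hb).
have := dotvv_ge0 hb.
move: (dotv hb hb) (dotv a a) (dotv a hb) (dotv n n) (dotv a n) (dotv hb n).
move=> hh aa ah nn an hn hh0 h1 h2.
have h3 : gamma / 2 * (aa - 2 * ah + hh) <= gamma / 2 * (L ^+ 2 * S).
  by rewrite ler_wpM2l ?divr_ge0//; lra.
have h4 : 0 <= gamma / 2 * ((1 - gamma * L) * hh).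
  by rewrite mulr_ge0 ?divr_ge0// mulr_ge0// subr_ge0.
lra.
Qed.
End Smooth.

(** * Integrable and square-integrable random vectors *)

Section L2toolbox.
Context {d : measure_display} {Omega : measurableType d} {R : realType}.
Variable P : probability Omega R.
Local Notation L1 := (Lfun P 1).
Local Notation L2 := (Lfun P 2%:E).

Implicit Types (X Y : Omega -> R).

(** Real-valued rather than extended, so that the linear arithmetic on
    expectations takes place in a field. *)
Definition Ex (X : Omega -> R) : R := \int[P]_w X w.

Lemma L1_integrable X : X \in L1 -> P.-integrable setT (EFin \o X).
Proof. by move/Lfun1_integrable. Qed.

Lemma L1_dominated X Y : measurable_fun setT X -> (forall w, `|X w| <= Y w) ->
  Y \in L1 -> X \in L1.
Proof.
move=> mX XY /L1_integrable iY; apply/Lfun1_integrable.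
apply: (le_integrable measurableT _ _ iY); first exact/measurable_EFinP.
by move=> w _ /=; rewrite lee_fin (le_trans (XY w))// ler_norm.
Qed.

Lemma L1_ge0 X c : measurable_fun setT X -> (forall w, 0 <= X w) ->
  (\int[P]_w (X w)%:E <= c%:E)%E -> X \in L1.
Proof.
move=> mX X0 Xc; apply/Lfun1_integrable/integrableP; split.
  exact/measurable_EFinP.
under eq_integral do rewrite gee0_abs ?lee_fin//.
by rewrite (le_lt_trans Xc)// ltry.
Qed.

Lemma L1D X Y : X \in L1 -> Y \in L1 -> (fun w => X w + Y w) \in L1.
Proof.
move=> /L1_integrable iX /L1_integrable iY; apply/Lfun1_integrable.
exact: (integrableD measurableT iX iY).
Qed.

Lemma L1Z a X : X \in L1 -> (fun w => a * X w) \in L1.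
Proof.
move=> /L1_integrable iX; apply/Lfun1_integrable.
exact: (integrableZl measurableT a iX).
Qed.

Lemma L1_cst (c : R) : (fun _ : Omega => c) \in L1.
Proof. exact: Lfun_cst. Qed.

Lemma L1_sum (I : Type) (s : seq I) (X : I -> Omega -> R) :
  (forall i, X i \in L1) -> (fun w => \sum_(i <- s) X i w) \in L1.
Proof.
move=> hX; elim: s => [|i s IH].
  by under eq_fun do rewrite big_nil; exact: L1_cst.
by under eq_fun do rewrite big_cons; exact: L1D.
Qed.

Lemma ExD X Y : X \in L1 -> Y \in L1 -> Ex (fun w => X w + Y w) = Ex X + Ex Y.
Proof. by move=> /L1_integrable iX /L1_integrable iY; exact: RintegralD. Qed.

Lemma ExZ a X : X \in L1 -> Ex (fun w => a * X w) = a * Ex X.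
Proof. by move=> /L1_integrable iX; exact: RintegralZl. Qed.

Lemma ExB X Y : X \in L1 -> Y \in L1 -> Ex (fun w => X w - Y w) = Ex X - Ex Y.
Proof. by move=> /L1_integrable iX /L1_integrable iY; exact: RintegralB. Qed.

Lemma Ex_cst c : Ex (fun=> c) = c.
Proof.
transitivity (c * fine (P setT)); first by rewrite /Ex Rintegral_cst.
by rewrite probability_setT mulr1.
Qed.

Lemma Ex_sum (I : Type) (s : seq I) (X : I -> Omega -> R) :
  (forall i, X i \in L1) ->
  Ex (fun w => \sum_(i <- s) X i w) = \sum_(i <- s) Ex (X i).
Proof.
move=> hX; elim: s => [|i s IH].
  by under eq_fun do rewrite big_nil; rewrite big_nil Ex_cst.
under eq_fun do rewrite big_cons; rewrite ExD ?big_cons ?IH//.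
exact: L1_sum.
Qed.

Lemma Ex_le X Y : X \in L1 -> Y \in L1 -> (forall w, X w <= Y w) ->
  Ex X <= Ex Y.
Proof.
by move=> /L1_integrable iX /L1_integrable iY XY; apply: le_Rintegral.
Qed.

Lemma integral_Ex X : X \in L1 -> (\int[P]_w (X w)%:E = (Ex X)%:E)%E.
Proof.
by move=> /L1_integrable iX; rewrite /Ex /Rintegral fineK// integrable_fin_num.
Qed.

Lemma Lfun2P X : measurable_fun setT X -> (fun w => X w ^+ 2) \in L1 ->
  X \in L2.
Proof.
move=> mX /L1_integrable/integrableP[_ iX].
rewrite inE; apply/andP; split; rewrite inE//= /finite_norm unlock /=.
rewrite poweR_lty//; apply: le_lt_trans iX.
apply: ge0_le_integral => //=.
- apply/measurable_EFinP; apply: (measurableT_comp (measurable_powR _)) => //.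
  exact: measurableT_comp.
- apply/measurable_EFinP; apply: measurableT_comp => //.
  exact: measurable_funX.
- by move=> w _; rewrite powR_mulrn// lee_fin normrX.
Qed.

Lemma L2_dominated X Y : measurable_fun setT X -> (forall w, X w ^+ 2 <= Y w) ->
  Y \in L1 -> X \in L2.
Proof.
move=> mX XY hY; apply: Lfun2P => //; apply: L1_dominated hY.
  exact: measurable_funX.
by move=> w; rewrite ger0_norm ?sqr_ge0.
Qed.

Lemma L2_measurable X : X \in L2 -> measurable_fun setT X.
Proof. by move=> /andP[]; rewrite inE. Qed.

Lemma L2M X Y : X \in L2 -> Y \in L2 -> (fun w => X w * Y w) \in L1.
Proof. exact: Lfun2_mul_Lfun1. Qed.

Lemma L2D X Y : X \in L2 -> Y \in L2 -> (fun w => X w + Y w) \in L2.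
Proof.
move=> hX hY.
apply: (@L2_dominated _ (fun w => 2 * (X w * X w) + 2 * (Y w * Y w))).
- by apply: measurable_funD; exact: L2_measurable.
- by move=> w; have := sqr_ge0 (X w - Y w); rewrite !expr2; lra.
- by apply: L1D; apply: L1Z; exact: L2M.
Qed.

Lemma L2Z a X : X \in L2 -> (fun w => a * X w) \in L2.
Proof.
move=> hX; apply: (@L2_dominated _ (fun w => a ^+ 2 * (X w * X w))).
- by apply: measurable_funM => //; exact: L2_measurable.
- by move=> w; rewrite exprMn expr2.
- by apply: L1Z; exact: L2M.
Qed.

Lemma L2_cst (c : R) : (fun _ : Omega => c) \in L2.
Proof. exact: Lfun_cst. Qed.

Lemma L2_sum (I : Type) (s : seq I) (X : I -> Omega -> R) :
  (forall i, X i \in L2) -> (fun w => \sum_(i <- s) X i w) \in L2.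
Proof.
move=> hX; elim: s => [|i s IH].
  by under eq_fun do rewrite big_nil; exact: L2_cst.
by under eq_fun do rewrite big_cons; exact: L2D.
Qed.

Section vectors.
Variable m : nat.
Implicit Types U V : Omega -> 'rV[R]_m.

Definition L2v U := forall j, (fun w => U w 0 j) \in L2.

Lemma L2vD U V : L2v U -> L2v V -> L2v (fun w => U w + V w).
Proof.
move=> hU hV j; under eq_fun do rewrite mxE.
by apply: L2D; [exact: hU|exact: hV].
Qed.

Lemma L2vZ a U : L2v U -> L2v (fun w => a *: U w).
Proof. by move=> hU j; under eq_fun do rewrite mxE; apply: L2Z; exact: hU. Qed.

Lemma L2vN U : L2v U -> L2v (fun w => - U w).
Proof. by move=> hU; under eq_fun do rewrite -scaleN1r; exact: L2vZ. Qed.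

Lemma L2v_cst u : L2v (fun=> u).
Proof. by move=> j; exact: L2_cst. Qed.

Lemma L2v_mean N (U : 'I_N -> Omega -> 'rV[R]_m) :
  (forall i, L2v (U i)) -> L2v (fun w => mean (fun i => U i w)).
Proof.
move=> hU; apply: L2vZ => j; under eq_fun do rewrite summxE.
by apply: L2_sum => i; exact: hU.
Qed.

Lemma L1_dotv U V : L2v U -> L2v V -> (fun w => dotv (U w) (V w)) \in L1.
Proof.
by move=> hU hV; apply: L1_sum => j; apply: L2M; [exact: hU|exact: hV].
Qed.

Lemma L1_enorm U : L2v U -> (fun w => enorm (U w) ^+ 2) \in L1.
Proof. by move=> hU; under eq_fun do rewrite enormE; exact: L1_dotv. Qed.

Lemma L2v_dominated U Y : (forall j, measurable_fun setT (fun w => U w 0 j)) ->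
  (forall w, enorm (U w) ^+ 2 <= Y w) -> Y \in L1 -> L2v U.
Proof.
move=> mU UY hY j; apply: L2_dominated hY => // w.
exact: le_trans (coord_le_enorm _ _) (UY w).
Qed.

End vectors.
End L2toolbox.

(** * Parallel restarted SGD *)

Section PRSGD.
Context {R : realType} {N m : nat} {d : 'I_N -> measure_display}
  {S : forall i, measurableType (d i)}.
Variables (D : forall i, probability (S i) R).
Variable (F : forall i, 'rV[R]_m -> S i -> R).
Variables (gamma : R) (I : nat) (y0 : 'rV[R]_m).
Arguments F : clear implicits.
Hypothesis mF : forall i y, measurable_fun setT (F i y).
Hypothesis dF : forall i s y, differentiable (fun u => F i u s) y.

Lemma measurable_prsgd d' (X : measurableType d')
    (z : forall i, nat -> X -> S i) t :
  (forall i tau, (1 <= tau <= t)%N -> measurable_fun setT (z i tau)) ->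
  forall s, (s <= t)%N -> forall i j,
  measurable_fun setT
    (fun p => prsgd F gamma I y0 (fun i tau => z i tau p) s i 0 j).
Proof.
move=> mz; elim=> [_ i j|s IH st i j]; first exact: measurable_cst.
have {}IH := IH (ltnW st).
rewrite /=; under eq_fun do rewrite mxE [X in _ + X]mxE [X in _ - X]mxE.
apply: measurable_funB.
  case: (I %| s.+1)%N => //=.
  rewrite /mean; under eq_fun do rewrite mxE summxE.
  apply: measurable_funM => //.
  by apply: measurable_sum_real => k; exact: IH.
apply: measurable_funM => //.
apply: (@measurable_gradient _ X R m (fun y p => F i y (z i s.+1 p))
  _ _ _ (IH i) j) => //.
by move=> y; exact: (measurableT_comp (mF y) (mz i s.+1 st)).
Qed.

Context {d0 : measure_display} {Omega : measurableType d0}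
  {P : probability Omega R}.
Variable zeta : forall i, nat -> {RV P >-> S i}.
Arguments zeta : clear implicits.
Local Notation K := ('I_N * nat)%type.
Let gens (J : set K) : set (set Omega) :=
  generators J (fun k : K => zeta k.1 k.2 : Omega -> S k.1).

(* Omega with the sigma-algebra of the samples indexed by J *)
Local Notation known J := (g_sigma_algebraType (gens J)).

Lemma measurable_generator (J : set K) i tau : J (i, tau) ->
  measurable_fun setT (zeta i tau : known J -> S i).
Proof.
move=> Ji _ B mB; rewrite setTI; apply: sub_sigma_algebra.
by exists (i, tau), B.
Qed.

Lemma history_generators t :
  history (fun i n => zeta i n) t = <<s gens [set k | (1 <= k.2 <= t)%N] >>.
Proof.
rewrite /history; congr <<s _ >>; apply/seteqP; split => A /=.
  by move=> [j [tau [B [h mB ->]]]]; exists (j, tau), B.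
by move=> [[j tau] [B [h mB ->]]]; exists j, tau, B.
Qed.

Let f_ i := expected_loss (D i) (F i).
Variables (L sigma G : R) (T : nat).
Hypothesis df_ : forall i (y : 'rV[R]_m), differentiable (f_ i) y.
Hypothesis lip_ : forall i (y u : 'rV[R]_m),
  enorm (gradient (f_ i) y - gradient (f_ i) u) <= L * enorm (y - u).
Hypothesis varF : forall i (y : 'rV[R]_m),
  ('E_(D i)[fun s : S i =>
     (enorm (gradient (fun u => F i u s) y - gradient (f_ i) y) ^+ 2)%R]
   <= (sigma ^+ 2)%:E)%E.
Hypothesis momF : forall i (y : 'rV[R]_m),
  ('E_(D i)[fun s : S i => (enorm (gradient (fun u => F i u s) y) ^+ 2)%R]
   <= (G ^+ 2)%:E)%E.
Hypothesis zetaD : forall i t, (1 <= t <= T)%N -> forall A : set (S i),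
  measurable A -> distribution P (zeta i t) A = D i A.
Hypothesis zeta_indep :
  mutually_independent (P := P) [set k : K | (1 <= k.2 <= T)%N]
    (S := fun k => S k.1) (fun k => zeta k.1 k.2).

(* x t is the state after t iterations; g t, h t and n t are the stochastic
   gradient, the exact gradient and the noise used in iteration t.+1 *)
Let x t w := prsgd F gamma I y0 (fun i tau => zeta i tau w) t.
Let g t w i := gradient (fun u => F i u (zeta i t.+1 w)) (x t w i).
Let h t w i := gradient (f_ i) (x t w i).
Let n t w i := g t w i - h t w i.
Let hist t := [set k : K | (1 <= k.2 <= t)%N].

Hypothesis condE : forall i t, (1 <= t <= T)%N -> forall j : 'I_m,
  is_cond_expectation P (history zeta t.-1)
    (fun w => gradient (fun u => F i u (zeta i t w)) (x t.-1 w i) 0 j)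
    (fun w => gradient (f_ i) (x t.-1 w i) 0 j).

Lemma gens_measurable J : gens J `<=` measurable.
Proof. exact: generators_measurable. Qed.

Lemma measurable_x J t i j : hist t `<=` J ->
  measurable_fun setT ((fun w => x t w i 0 j) : known J -> R).
Proof.
move=> tJ.
apply: (@measurable_prsgd _ (known J)
  (fun i tau w => zeta i tau w) t) => //.
by move=> k tau ht; apply: measurable_generator; exact: tJ.
Qed.

Lemma measurable_h J t i j : hist t `<=` J ->
  measurable_fun setT ((fun w => h t w i 0 j) : known J -> R).
Proof.
move=> tJ.
apply: (@measurable_gradient _ (known J) R m (fun y _ => f_ i y)) => //.
by move=> k; exact: measurable_x.
Qed.

Lemma measurable_g J t i j : hist t `<=` J -> J (i, t.+1) ->
  measurable_fun setT ((fun w => g t w i 0 j) : known J -> R).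
Proof.
move=> tJ Ji.
apply: (@measurable_gradient _ (known J) R m
  (fun y w => F i y (zeta i t.+1 w))) => //.
  by move=> y; exact: (measurableT_comp (mF y) (measurable_generator Ji)).
by move=> k; exact: measurable_x.
Qed.

Lemma measurable_frozen t i j :
  measurable_fun setT (fun z : known (hist t) * S i =>
    gradient (fun u => F i u z.2) (x t z.1 i) 0 j).
Proof.
apply: (@measurable_gradient _ (known (hist t) * S i)%type R m
  (fun y z => F i y z.2)) => //.
  by move=> y; exact: (measurableT_comp (mF y) measurable_snd).
by move=> k; apply: (measurableT_comp (measurable_x _ _ _) measurable_fst).
Qed.

Lemma zeta_law i t : (t < T)%N ->
  forall B, measurable B -> P (zeta i t.+1 @^-1` B) = D i B.
Proof. by move=> tT B mB; exact: zetaD. Qed.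

Lemma zeta_independent J i t : (t < T)%N -> J `<=` hist T -> ~ J (i, t.+1) ->
  independent_of (zeta i t.+1) (gens J).
Proof.
move=> tT JT nJ A B HA mB.
exact: (mutually_independent_rest zeta_indep JT _ nJ HA mB).
Qed.

Lemma hist_sub t : (t <= T)%N -> hist t `<=` hist T.
Proof.
by move=> tT k /andP[k0 kt]; apply/andP; split=> //; exact: (leq_trans kt).
Qed.

Lemma hist_next t i : ~ hist t (i, t.+1).
Proof. by rewrite /hist /= ltnn. Qed.

(** The moment assumptions hold at each deterministic point; the point x_i^t
    is random but independent of the sample used there, so freezing it
    transports the bound. *)
Lemma moment_g t i : (t < T)%N ->
  (\int[P]_w (enorm (g t w i) ^+ 2)%:E <= (G ^+ 2)%:E)%E.
Proof.
move=> tT.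
apply: (@freezing_bound _ _ _ _ _ P (D i) (zeta i t.+1) (zeta_law tT) _
  (@gens_measurable (hist t))
  (zeta_independent tT (hist_sub (ltnW tT)) (@hist_next t i))
  (fun z => (enorm (gradient (fun u => F i u z.2) (x t z.1 i)) ^+ 2)%:E)).
- apply/measurable_EFinP; under eq_fun do rewrite enormE.
  apply: measurable_sum_real => j.
  by apply: measurable_funM; exact: measurable_frozen.
- by move=> z; rewrite lee_fin sqr_ge0.
- by move=> w; have := momF i (x t w i); rewrite unlock.
Qed.

Lemma moment_n t i : (t < T)%N ->
  (\int[P]_w (enorm (n t w i) ^+ 2)%:E <= (sigma ^+ 2)%:E)%E.
Proof.
move=> tT.
apply: (@freezing_bound _ _ _ _ _ P (D i) (zeta i t.+1) (zeta_law tT) _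
  (@gens_measurable (hist t))
  (zeta_independent tT (hist_sub (ltnW tT)) (@hist_next t i))
  (fun z => (enorm (gradient (fun u => F i u z.2) (x t z.1 i)
                    - gradient (f_ i) (x t z.1 i)) ^+ 2)%:E)).
- apply/measurable_EFinP; under eq_fun do rewrite enormE.
  have M j : measurable_fun setT (fun z : known (hist t) * S i =>
      (gradient (fun u => F i u z.2) (x t z.1 i)
       - gradient (f_ i) (x t z.1 i)) 0 j).
    under eq_fun do rewrite mxE [X in _ + X]mxE.
    apply: measurable_funB; first exact: measurable_frozen.
    exact: (measurableT_comp (measurable_h _ _ _) measurable_fst).
  by apply: measurable_sum_real => j; apply: measurable_funM.
- by move=> z; rewrite lee_fin sqr_ge0.
- by move=> w; have := varF i (x t w i); rewrite unlock.
Qed.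

Hypotheses (N_gt0 : (0 < N)%N) (I_gt0 : (0 < I)%N).
Hypotheses (L_ge0 : 0 <= L) (gamma_ge0 : 0 <= gamma).
Let f := mean_loss D F.
Let xbar t w : 'rV[R]_m := mean (x t w).
Local Notation L1 := (Lfun P 1).
Local Notation L2 := (Lfun P 2%:E).

Lemma measurable_of_gens J (u : Omega -> R) :
  measurable_fun setT (u : known J -> R) ->
  measurable_fun setT u.
Proof.
move=> mu.
exact: (measurableT_comp mu (measurable_forget (@gens_measurable J))).
Qed.

Lemma measurable_n J t i j : hist t `<=` J -> J (i, t.+1) ->
  measurable_fun setT ((fun w => n t w i 0 j) : known J -> R).
Proof.
move=> tJ Ji; rewrite /n; under eq_fun do rewrite mxE [X in _ + X]mxE.
by apply: measurable_funB; [exact: measurable_g|exact: measurable_h].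
Qed.

Let now t i := hist t `|` [set (i, t.+1)].

Lemma L2v_of_moment (U : Omega -> 'rV[R]_m) c :
  (forall j, measurable_fun setT (fun w => U w 0 j)) ->
  (\int[P]_w (enorm (U w) ^+ 2)%:E <= c%:E)%E -> L2v P U.
Proof.
move=> mU Uc; apply: (L2v_dominated mU (fun w => lexx (enorm (U w) ^+ 2))).
apply: (L1_ge0 _ _ Uc) => [|w]; last exact: sqr_ge0.
under eq_fun do rewrite enormE.
by apply: measurable_sum_real => j; apply: measurable_funM.
Qed.

Lemma L2v_g t i : (t < T)%N -> L2v P (fun w => g t w i).
Proof.
move=> tT; apply: (L2v_of_moment _ (moment_g i tT)) => j.
apply: (@measurable_of_gens (now t i)).
by apply: measurable_g; [left|right].
Qed.

Lemma L2v_n t i : (t < T)%N -> L2v P (fun w => n t w i).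
Proof.
move=> tT; apply: (L2v_of_moment _ (moment_n i tT)) => j.
apply: (@measurable_of_gens (now t i)).
by apply: measurable_n; [left|right].
Qed.

Lemma L2v_h t i : (t < T)%N -> L2v P (fun w => h t w i).
Proof.
move=> tT; rewrite [X in L2v P X](_ : _ = (fun w => g t w i + - n t w i)).
  by apply: L2vD; [exact: L2v_g|apply: L2vN; exact: L2v_n].
by apply/funext => w; rewrite /n opprB addrCA subrr addr0.
Qed.

Lemma x_next t w i : x t.+1 w i =
  (if (I %| t.+1)%N then xbar t w else x t w i) - gamma *: g t w i.
Proof. by []. Qed.

Lemma L2v_x t i : (t <= T)%N -> L2v P (fun w => x t w i).
Proof.
elim: t i => [|t IH] i tT; first exact: L2v_cst.
have IHt k := IH k (ltnW tT).
rewrite /x /=; apply: L2vD; last by apply/L2vN/L2vZ/L2v_g.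
by case: (I %| t.+1)%N; [exact: L2v_mean|exact: IHt].
Qed.

Lemma L2v_xbar t : (t <= T)%N -> L2v P (xbar t).
Proof. by move=> tT; apply: L2v_mean => i; exact: L2v_x. Qed.

Lemma measurable_gradf J t j : hist t `<=` J ->
  measurable_fun setT ((fun w => gradient f (xbar t w) 0 j) :
    known J -> R).
Proof.
move=> tJ.
apply: (@measurable_gradient _ (known J) R m (fun y _ => f y)) => //.
  by move=> _ y; exact: differentiable_mean_fun.
move=> k; rewrite /xbar /mean; under eq_fun do rewrite mxE summxE.
apply: measurable_funM => //; apply: measurable_sum_real => i.
exact: measurable_x.
Qed.

Lemma L2v_gradf t : (t <= T)%N -> L2v P (fun w => gradient f (xbar t w)).
Proof.
move=> tT; apply: (@L2v_dominated _ _ _ _ _ _ (fun w =>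
  2 * (L ^+ 2 * enorm (xbar t w + - y0) ^+ 2) +
  2 * enorm (gradient f y0) ^+ 2)).
- by move=> j; apply: (@measurable_of_gens (hist t)); exact: measurable_gradf.
- move=> w; set a := gradient f _; set b := gradient f y0.
  have h1 : enorm (a - b) ^+ 2 <= L ^+ 2 * enorm (xbar t w - y0) ^+ 2.
    rewrite -exprMn ler_pXn2r ?nnegrE ?mulr_ge0 ?enorm_ge0//.
    exact: lipschitz_gradient_mean_fun.
  have := dotvv_ge0 (a - 2 *: b); move: h1; clearbody a b.
  rewrite !enormE !dotvE (dotvC b a) -enormE; lra.
- apply: L1D; last exact: L1_cst.
  by do 2 apply: L1Z; apply/L1_enorm/L2vD; [exact: L2v_xbar|exact: L2v_cst].
Qed.

(** The unbiasedness hypothesis conditions on the history only. Here u may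
    also depend on the other workers' samples of the current iteration: the
    noises of two workers are then uncorrelated. *)
Lemma n_orthogonal J t i j (u : Omega -> R) : (t < T)%N ->
  hist t `<=` J -> J `<=` hist T -> ~ J (i, t.+1) -> u \in L2 ->
  measurable_fun setT (u : known J -> R) ->
  Ex P (fun w => u w * n t w i 0 j) = 0.
Proof.
move=> tT tJ JT nJ u2 mu.
have gg : gens (hist t) `<=` gens J.
  by move=> A [k [B [hk mB ->]]]; exists k, B; split => //; exact: tJ.
have ug : (fun w => u w * g t w i 0 j) \in L1 by apply: L2M => //; exact: L2v_g.
have uh : (fun w => u w * h t w i 0 j) \in L1 by apply: L2M => //; exact: L2v_h.
have := condE i (t := t.+1) tT j; rewrite history_generators => cE.
have := @integral_mul_cond_expectation _ _ _ _ _ P (D i) (zeta i t.+1)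
  (zeta_law tT) (gens (hist t)) (gens J)
  (fun z => gradient (fun u => F i u z.2) (x t z.1 i) 0 j)
  (fun w => h t w i 0 j) u (@gens_measurable J) gg (zeta_independent tT JT nJ)
  (@measurable_frozen t i j) cE mu (L1_integrable ug).
move=> /(congr1 fine) E.
rewrite (_ : (fun w => _) = (fun w => u w * g t w i 0 j - u w * h t w i 0 j)).
  by rewrite (ExB ug uh); apply/eqP; rewrite subr_eq0; apply/eqP.
by apply/funext => w; rewrite mxE [X in _ + X]mxE mulrBr.
Qed.

Lemma Ex_dotv_n t i (b : Omega -> 'rV[R]_m) J : (t < T)%N ->
  hist t `<=` J -> J `<=` hist T -> ~ J (i, t.+1) -> L2v P b ->
  (forall j, measurable_fun setT ((fun w => b w 0 j) : known J -> R)) ->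
  Ex P (fun w => dotv (b w) (n t w i)) = 0.
Proof.
move=> tT tJ JT nJ b2 mb; rewrite /dotv Ex_sum => [|j].
  by rewrite big1// => j _; exact: (n_orthogonal j tT tJ JT nJ (b2 j) (mb j)).
by apply: L2M; [exact: b2|exact: L2v_n].
Qed.

Lemma Ex_dotv_mean_n t (b : Omega -> 'rV[R]_m) : (t < T)%N -> L2v P b ->
  (forall j, measurable_fun setT
     ((fun w => b w 0 j) : known (hist t) -> R)) ->
  Ex P (fun w => dotv (b w) (mean (n t w))) = 0.
Proof.
move=> tT b2 mb; rewrite /mean; under eq_fun do rewrite dotvZr dotv_sumr.
have Li i : (fun w => dotv (b w) (n t w i)) \in L1.
  by apply: L1_dotv => //; exact: L2v_n.
rewrite (ExZ _ (L1_sum _ Li)) (Ex_sum _ Li) big1 ?mulr0// => i _.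
apply: (Ex_dotv_n tT _ _ _ b2 mb) => //; first exact/hist_sub/ltnW.
exact: hist_next.
Qed.

Lemma Ex_enorm_n t i : (t < T)%N ->
  Ex P (fun w => enorm (n t w i) ^+ 2) <= sigma ^+ 2.
Proof.
move=> tT; have := moment_n i tT; rewrite integral_Ex ?lee_fin//.
exact/L1_enorm/L2v_n.
Qed.

Lemma Ex_enorm_g t i : (t < T)%N ->
  Ex P (fun w => enorm (g t w i) ^+ 2) <= G ^+ 2.
Proof.
move=> tT; have := moment_g i tT; rewrite integral_Ex ?lee_fin//.
exact/L1_enorm/L2v_g.
Qed.

Lemma Ex_cross_n t i k : (t < T)%N -> i != k ->
  Ex P (fun w => dotv (n t w i) (n t w k)) = 0.
Proof.
move=> tT ik; apply: (@Ex_dotv_n t k _ (now t i)) => //.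
- by left.
- move=> k' [|->]; first exact/hist_sub/ltnW.
  by rewrite /hist /= tT.
- by case => [/hist_next//|[/esym/eqP]]; exact/negP.
- exact: L2v_n.
- by move=> j; apply: measurable_n; [left|right].
Qed.

(** Linear speedup: the cross terms between workers vanish, so averaging
    divides the variance by N. *)
Lemma Ex_enorm_mean_n t : (t < T)%N ->
  Ex P (fun w => enorm (mean (n t w)) ^+ 2) <= N%:R^-1 * sigma ^+ 2.
Proof.
move=> tT.
have Lik i k : (fun w => dotv (n t w i) (n t w k)) \in L1.
  by apply: L1_dotv; exact: L2v_n.
have Li i := L1_sum (index_enum 'I_N) (Lik i).
rewrite (_ : (fun w => _) = (fun w => N%:R^-1 * (N%:R^-1 *
    \sum_i \sum_k dotv (n t w i) (n t w k)))); last first.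
  apply/funext => w; rewrite enormE {1}/mean dotvZl dotvZr; congr (_ * (_ * _)).
  rewrite dotv_sumr; apply: eq_bigr => i _.
  by rewrite dotvC dotv_sumr.
rewrite (ExZ _ (L1Z _ (L1_sum _ Li))) (ExZ _ (L1_sum _ Li)) (Ex_sum _ Li).
rewrite ler_wpM2l ?invr_ge0//; apply: le_mean_const => // i.
rewrite (Ex_sum _ (Lik i)) (bigD1 i)//= big1 => [|k ki].
  rewrite addr0 (le_trans _ (Ex_enorm_n i tT))//.
  by under eq_fun do rewrite -enormE.
by apply: Ex_cross_n; rewrite // eq_sym.
Qed.

(* A restart takes the gradient step of the same iteration from the average,
   so steps counts it and starts from 1. *)
Let anchor := fix anchor t w : 'rV[R]_m :=
  if t is t'.+1 then
    if (I %| t'.+1)%N then xbar t' w else anchor t' w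
  else y0.
Let steps := fix steps t : nat :=
  if t is t'.+1 then
    if (I %| t'.+1)%N then 1%N else (steps t').+1
  else 0%N.

Lemma steps_le t : (steps t <= I)%N.
Proof.
suff : (steps t <= (t %% I).+1)%N.
  by move=> /leq_trans; apply; rewrite ltn_mod.
elim: t => [|t IH] //=; rewrite modnS; case: ifP => // _.
Qed.

Lemma L2v_anchor t : (t <= T)%N -> L2v P (anchor t).
Proof.
elim: t => [|t IH] tT /=; first exact: L2v_cst.
by case: (I %| t.+1)%N; [apply: L2v_xbar|apply: IH]; exact: ltnW.
Qed.

(** Since its anchor a worker has made steps t gradient steps of L2 norm at
    most gamma * G each: this is the triangle inequality in L2, in squared
    form. *)
Lemma drift_anchor t i : (t <= T)%N ->
  Ex P (fun w => enorm (x t w i - anchor t w) ^+ 2) <=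
  (gamma * (steps t)%:R) ^+ 2 * G ^+ 2.
Proof.
elim: t => [|t IH] tT.
  rewrite /= mulr0 expr0n mul0r [X in Ex P X](_ : _ = fun=> 0) ?Ex_cst//.
  apply/funext => w; rewrite subrr enormE /dotv big1// => j _.
  by rewrite mxE mul0r.
have Lg := L1_enorm (L2v_g i tT).
have first_step (c : Omega -> 'rV[R]_m) :
    Ex P (fun w => enorm (c w - gamma *: g t w i - c w) ^+ 2) <=
    (gamma * 1%:R) ^+ 2 * G ^+ 2.
  under eq_fun do rewrite addrAC subrr add0r enormN2 enormZ2.
  by rewrite mulr1 (ExZ _ Lg) ler_wpM2l ?sqr_ge0//; exact: Ex_enorm_g.
rewrite /=; under eq_fun do rewrite x_next.
case: (I %| t.+1)%N; first exact: first_step.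
have La : L2v P (fun w => x t w i - anchor t w).
  by apply: L2vD; [exact/L2v_x/ltnW|exact/L2vN/L2v_anchor/ltnW].
(* Young's weight 1/k is unavailable for k = 0, that is, before any step *)
have := IH (ltnW tT); have [t0|] := eqVneq (steps t) 0%N.
  have t00 : t = 0%N by move: t0; case: (t) => //= s; case: ifP.
  by subst t => _; exact: (first_step (fun=> y0)).
move: (steps t) => k k0.
have kp : (0 : R) < k%:R by rewrite ltr0n lt0n.
have Le := L1_enorm La.
move=> Ea.
apply: (@le_trans _ _ (Ex P (fun w =>
    (1 + k%:R^-1) * enorm (x t w i - anchor t w) ^+ 2
   + (1 + k%:R) * gamma ^+ 2 * enorm (g t w i) ^+ 2))).
  apply: Ex_le.
  - apply: L1_enorm; apply: L2vD; last exact/L2vN/L2v_anchor/ltnW.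
    by apply: L2vD; [exact/L2v_x/ltnW|exact/L2vN/L2vZ/L2v_g].
  - by apply: L1D; exact: L1Z.
  - move=> w; rewrite addrAC (le_trans (enormB_young _ _ kp))// enormZ2.
    by rewrite mulrA.
rewrite (ExD (L1Z _ Le) (L1Z _ Lg)) (ExZ _ Le) (ExZ _ Lg).
have h1 : (1 + k%:R^-1) * Ex P (fun w => enorm (x t w i - anchor t w) ^+ 2) <=
    (1 + k%:R^-1) * ((gamma * k%:R) ^+ 2 * G ^+ 2).
  by rewrite ler_wpM2l// addr_ge0// invr_ge0.
have h2 : (1 + k%:R) * gamma ^+ 2 * Ex P (fun w => enorm (g t w i) ^+ 2) <=
    (1 + k%:R) * gamma ^+ 2 * G ^+ 2.
  by rewrite ler_wpM2l ?mulr_ge0 ?addr_ge0 ?sqr_ge0//; exact: Ex_enorm_g.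
apply: (le_trans (lerD h1 h2)).
rewrite -[k.+1%:R]natr1 le_eqVlt; apply/orP; left; apply/eqP.
by field; rewrite gt_eqF.
Qed.

(** The anchor is common to all workers, so their spread around the mean is at
    most their spread around the anchor. *)
Lemma drift_mean t : (t <= T)%N ->
  Ex P (fun w => N%:R^-1 * \sum_i enorm (xbar t w - x t w i) ^+ 2) <=
  (gamma * I%:R) ^+ 2 * G ^+ 2.
Proof.
move=> tT.
have L2xi i : (fun w => enorm (xbar t w - x t w i) ^+ 2) \in L1.
  by apply/L1_enorm/L2vD; [exact: L2v_xbar|exact/L2vN/L2v_x].
have L2ai i : (fun w => enorm (x t w i - anchor t w) ^+ 2) \in L1.
  by apply/L1_enorm/L2vD; [exact: L2v_x|exact/L2vN/L2v_anchor].
apply: (@le_trans _ _ (Ex P (fun w =>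
    N%:R^-1 * \sum_i enorm (x t w i - anchor t w) ^+ 2))).
  apply: Ex_le; [exact/L1Z/L1_sum|exact/L1Z/L1_sum|] => w.
  by rewrite ler_wpM2l ?invr_ge0//; exact: sum_dist_mean_le.
rewrite (ExZ _ (L1_sum _ L2ai)) (Ex_sum _ L2ai).
apply: le_mean_const => // i; apply: (le_trans (drift_anchor i tT)).
rewrite ler_wpM2r ?sqr_ge0// ler_pXn2r ?nnegrE ?mulr_ge0//.
by rewrite ler_wpM2l// ler_nat steps_le.
Qed.

Variable fstar : R.
Hypothesis fmin : forall y, fstar <= f y.

Lemma xbar_next t w : xbar t.+1 w = xbar t w - gamma *: mean (g t w).
Proof.
rewrite /xbar /mean.
under eq_bigr do rewrite x_next.
rewrite big_split /= sumrN -scaler_sumr scalerDr scalerN scalerA mulrC -scalerA.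
case: (I %| t.+1)%N => //; congr (_ - _).
rewrite sumr_const card_ord -[X in _ *: X]scaler_nat scalerA.
by rewrite mulVf ?scale1r// pnatr_eq0 -lt0n.
Qed.

(** f is bounded below by its minimum and above by the quadratic model of the
    descent lemma at y0. *)
Lemma L1_f t : (t <= T)%N -> (fun w => f (xbar t w)) \in L1.
Proof.
move=> tT; pose B w := f y0 + dotv (gradient f y0) (xbar t w - y0) +
  L / 2 * enorm (xbar t w - y0) ^+ 2.
have L2b : L2v P (fun w => xbar t w - y0).
  by apply: L2vD; [exact: L2v_xbar|exact: L2v_cst].
have L1B : B \in L1.
  apply: L1D; last exact/L1Z/L1_enorm.
  by apply: L1D; [exact: L1_cst|apply: L1_dotv => //; exact: L2v_cst].
have fB w : f (xbar t w) <= B w.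
  apply: descent_lemma; first exact: differentiable_mean_fun.
  by move=> u v; exact: lipschitz_gradient_mean_fun.
apply: (@L1_dominated _ _ _ _ _ (fun w => (B w + - fstar) + `|fstar|)).
- apply: (@measurable_caratheodory _ Omega R m (fun y _ => f y)) => //.
    by move=> _ y; apply/differentiable_continuous/differentiable_mean_fun.
  by move=> j; apply: L2_measurable; exact: (L2v_xbar tT).
- move=> w; have := fB w; have := fmin (xbar t w).
  move: (f _) (B w) => a b h1 h2.
  have := ler_norm (- fstar); rewrite normrN => h3.
  have := ler_norm fstar => h4.
  by rewrite ler_norml; apply/andP; split; lra.
- by apply: L1D; [apply: L1D => //; exact: L1_cst|exact: L1_cst].
Qed.

Hypothesis gammaL : gamma * L <= 1.

(** The coefficient b of the linear noise term is determined by the history, so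
    this term has mean zero. *)
Lemma expected_step t : (t < T)%N ->
  Ex P (fun w => f (xbar t.+1 w)) +
    gamma / 2 * Ex P (fun w => enorm (gradient f (xbar t w)) ^+ 2) <=
  Ex P (fun w => f (xbar t w)) +
    gamma * L ^+ 2 / 2 * ((gamma * I%:R) ^+ 2 * G ^+ 2) +
    L * gamma ^+ 2 / 2 * (N%:R^-1 * sigma ^+ 2).
Proof.
move=> tT.
pose b w := (L * gamma ^+ 2) *: mean (h t w) - gamma *: gradient f (xbar t w).
have L1f := L1_f tT; have L1f' := L1_f (ltnW tT).
have L1a := L1_enorm (L2v_gradf (ltnW tT)).
have L2b : L2v P b.
  by apply: L2vD; [apply: L2vZ; apply: L2v_mean => i; exact: L2v_h
                  |apply/L2vN/L2vZ/L2v_gradf/ltnW].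
have L2n : L2v P (fun w => mean (n t w)) by apply: L2v_mean => i; exact: L2v_n.
have L1bn := L1_dotv L2b L2n.
have L1n := L1_enorm L2n.
have L1d : (fun w => N%:R^-1 * \sum_i enorm (xbar t w - x t w i) ^+ 2) \in L1.
  apply/L1Z/L1_sum => i; apply/L1_enorm/L2vD; first exact/L2v_xbar/ltnW.
  exact/L2vN/L2v_x/ltnW.
have E : Ex P (fun w => f (xbar t.+1 w) +
    gamma / 2 * enorm (gradient f (xbar t w)) ^+ 2)
  <= Ex P (fun w => f (xbar t w) +
    gamma * L ^+ 2 / 2 * (N%:R^-1 * \sum_i enorm (xbar t w - x t w i) ^+ 2) +
    dotv (b w) (mean (n t w)) + L * gamma ^+ 2 / 2 * enorm (mean (n t w)) ^+ 2).
  apply: Ex_le.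
  - by apply: L1D => //; exact: L1Z.
  - by apply: L1D; [apply: L1D => //; apply: L1D => //; exact: L1Z|exact: L1Z].
  - by move=> w; rewrite xbar_next; exact: descent_step.
move: E; rewrite (ExD L1f (L1Z _ L1a)) (ExZ _ L1a).
rewrite (ExD (L1D (L1D L1f' (L1Z _ L1d)) L1bn) (L1Z _ L1n)).
rewrite (ExD (L1D L1f' (L1Z _ L1d)) L1bn) (ExD L1f' (L1Z _ L1d)).
rewrite (ExZ _ L1d) (ExZ _ L1n) Ex_dotv_mean_n//; last first.
  move=> j; rewrite /b.
  under eq_fun do
    rewrite mxE [X in X + _]mxE [X in _ + X]mxE [X in _ - X]mxE.
  apply: measurable_funB; apply: measurable_funM => //; last first.
    exact: measurable_gradf.
  rewrite /mean; under eq_fun do rewrite mxE summxE.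
  apply: measurable_funM => //; apply: measurable_sum_real => i.
  exact: measurable_h.
rewrite addr0 => E; apply: (le_trans E); rewrite -!addrA lerD2l; apply: lerD.
  apply: ler_wpM2l; last exact/drift_mean/ltnW.
  by rewrite divr_ge0// mulr_ge0// sqr_ge0.
apply: ler_wpM2l; last exact: Ex_enorm_mean_n.
by rewrite divr_ge0// mulr_ge0// sqr_ge0.
Qed.

Lemma telescoped_steps t : (t <= T)%N ->
  Ex P (fun w => f (xbar t w)) +
    gamma / 2 *
      \sum_(0 <= s < t) Ex P (fun w => enorm (gradient f (xbar s w)) ^+ 2) <=
  f (mean (fun _ : 'I_N => y0)) +
    t%:R * (gamma * L ^+ 2 / 2 * ((gamma * I%:R) ^+ 2 * G ^+ 2) +
    L * gamma ^+ 2 / 2 * (N%:R^-1 * sigma ^+ 2)).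
Proof.
elim: t => [|t IH] tT.
  rewrite big_geq// mulr0 mul0r !addr0.
  have x0 w : xbar 0 w = mean (fun _ : 'I_N => y0) by [].
  by under eq_fun do rewrite x0; rewrite Ex_cst.
rewrite big_nat_recr//= mulrDr -[t.+1%:R]natr1 mulrDl mul1r.
have := IH (ltnW tT); have := expected_step tT.
move: (Ex P (fun w => f (xbar t.+1 w))) (Ex P (fun w => f (xbar t w))).
move: (gamma / 2 * \sum_(0 <= s < t) _) (gamma / 2 * Ex P _).
move: (gamma * _ / 2 * _).
by move: (L * _ / 2 * _) (f _) => *; lra.
Qed.

Lemma average_gradient_bound :
  gamma / 2 *
    \sum_(0 <= s < T) Ex P (fun w => enorm (gradient f (xbar s w)) ^+ 2) <=
  f (mean (fun _ : 'I_N => y0)) - fstar +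
    T%:R * (gamma * L ^+ 2 / 2 * ((gamma * I%:R) ^+ 2 * G ^+ 2) +
    L * gamma ^+ 2 / 2 * (N%:R^-1 * sigma ^+ 2)).
Proof.
have := telescoped_steps (leqnn T).
have : fstar <= Ex P (fun w => f (xbar T w)).
  rewrite -[leLHS](Ex_cst P).
  by apply: Ex_le => //; [exact: L1_cst|exact: L1_f].
by move: (Ex P _) (gamma / 2 * _) (f _) (T%:R * _) => *; lra.
Qed.

Lemma expectation_sum_gradient :
  (\sum_(1 <= t < T.+1)
     'E_P[fun w => (enorm (gradient f (xbar t.-1 w)) ^+ 2)%R] =
   (\sum_(0 <= s < T) Ex P (fun w => enorm (gradient f (xbar s w)) ^+ 2))%:E)%E.
Proof.
rewrite big_add1 /= -sumEFin; apply: eq_big_nat => t /andP[_ tT].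
by rewrite unlock integral_Ex//; apply/L1_enorm/L2v_gradf/ltnW.
Qed.

End PRSGD.

(** * Choice of the parameters *)

(** Everything is a rational function of the square roots of N and T. *)
Lemma rate_arithmetic (R : realType) (N T I : nat)
    (L G sigma Delta S gamma : R) :
  (0 < N)%N -> (0 < T)%N -> 0 < L ->
  gamma = Num.sqrt N%:R / (L * Num.sqrt T%:R) ->
  gamma / 2 * S <= Delta +
    T%:R * (gamma * L ^+ 2 / 2 * ((gamma * I%:R) ^+ 2 * G ^+ 2) +
    L * gamma ^+ 2 / 2 * (N%:R^-1 * sigma ^+ 2)) ->
  T%:R^-1 * S <= 2 * L / Num.sqrt (N * T)%:R * Delta
                + 4 * N%:R / T%:R * I%:R ^+ 2 * G ^+ 2
                + 1 / Num.sqrt (N * T)%:R * sigma ^+ 2.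
Proof.
move=> N0 T0 L0 ->.
rewrite natrM sqrtrM ?ler0n//.
have : 0 < Num.sqrt N%:R :> R by rewrite sqrtr_gt0 ltr0n.
have : 0 < Num.sqrt T%:R :> R by rewrite sqrtr_gt0 ltr0n.
have : N%:R = Num.sqrt N%:R ^+ 2 :> R by rewrite sqr_sqrtr.
have : T%:R = Num.sqrt T%:R ^+ 2 :> R by rewrite sqr_sqrtr.
move: (Num.sqrt N%:R) (Num.sqrt T%:R) => a b -> -> b0 a0.
move: (I%:R : R) => r h.
have a00 : a != 0 by rewrite gt_eqF.
have b00 : b != 0 by rewrite gt_eqF.
have L00 : L != 0 by rewrite gt_eqF.
have c0 : 0 < 2 * L / (a * b) by rewrite divr_gt0 ?mulr_gt0.
have -> : (b ^+ 2)^-1 * S = 2 * L / (a * b) * (a / (L * b) / 2 * S).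
  by field; rewrite a00 b00 L00.
apply: (@le_trans _ _ (2 * L / (a * b) * Delta
   + a ^+ 2 / b ^+ 2 * r ^+ 2 * G ^+ 2 + 1 / (a * b) * sigma ^+ 2)).
  rewrite (le_trans (ler_wpM2l (ltW c0) h))// le_eqVlt.
  apply/orP; left; apply/eqP.
  by field; rewrite a00 b00 L00.
rewrite lerD2r lerD2l !ler_wpM2r ?sqr_ge0// ?invr_ge0 ?sqr_ge0//.
by rewrite ler_peMl ?sqr_ge0// ler1n.
Qed.

(** In terms of the fourth roots q of N and p of T, the hypothesis is
    I <= p / q^3 and the claim is (q / p)^4 I^2 <= 1 / (q p)^2. *)
Lemma short_interval_rate (R : realType) (N T I : nat) (G : R) :
  (0 < N)%N -> (0 < T)%N -> (I%:R : R) <= T%:R `^ (1 / 4) / N%:R `^ (3 / 4) ->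
  4 * N%:R / T%:R * I%:R ^+ 2 * G ^+ 2 <= 4 / Num.sqrt (N * T)%:R * G ^+ 2.
Proof.
move=> N0 T0 hI; rewrite ler_wpM2r ?sqr_ge0//.
rewrite natrM sqrtrM ?ler0n//.
have N0R : (0 : R) < N%:R by rewrite ltr0n.
have T0R : (0 : R) < T%:R by rewrite ltr0n.
have quarter (c : R) : 0 <= c -> (c `^ (1 / 4)) ^+ 2 = Num.sqrt c.
  move=> c0; rewrite -powR12_sqrt// -powR_mulrn ?powR_ge0// -powRrM.
  by congr (_ `^ _); field.
have cube : N%:R `^ (3 / 4) = (N%:R `^ (1 / 4)) ^+ 3 :> R.
  rewrite -powR_mulrn ?powR_ge0// -powRrM.
  by congr (_ `^ _); field.
move: hI; rewrite cube -!quarter ?ler0n//.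
have : 0 < N%:R `^ (1 / 4) :> R by rewrite powR_gt0.
have : 0 < T%:R `^ (1 / 4) :> R by rewrite powR_gt0.
have : N%:R = (N%:R `^ (1 / 4)) ^+ 4 :> R.
  by rewrite (exprM _ 2 2) quarter ?sqr_sqrtr ?ler0n.
have : T%:R = (T%:R `^ (1 / 4)) ^+ 4 :> R.
  by rewrite (exprM _ 2 2) quarter ?sqr_sqrtr ?ler0n.
move: (N%:R `^ (1 / 4)) (T%:R `^ (1 / 4)) => q p -> -> p0 q0 hI.
have : (I%:R : R) ^+ 2 <= (p / q ^+ 3) ^+ 2.
  by rewrite lerXn2r ?nnegrE// divr_ge0 ?exprn_ge0 ?ltW.
move: (I%:R ^+ 2 : R) => r h.
have c0 : 0 <= 4 * q ^+ 4 / p ^+ 4.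
  by rewrite divr_ge0 ?mulr_ge0 ?exprn_ge0 ?ltW.
rewrite (le_trans (ler_wpM2l c0 h))// le_eqVlt; apply/orP; left; apply/eqP.
by field; rewrite !gt_eqF.
Qed.

Theorem corollary1 (R : realType) :
  exists C : R -> R -> R -> R -> R,
  forall (N m : nat)
    (d : 'I_N -> measure_display) (S : forall i, measurableType (d i))
    (D : forall i, probability (S i) R)
    (F : forall i, 'rV[R]_m -> S i -> R)
    (L sigma G fstar : R)
    (d0 : measure_display) (Omega : measurableType d0)
    (P : probability Omega R)
    (zeta : forall i, nat -> {RV P >-> S i})
    (y0 : 'rV[R]_m) (gamma : R) (I T : nat),
  let f_ i := expected_loss (D i) (F i) in
  let f := mean_loss D F in
  let x t w := prsgd F gamma I y0 (fun i tau => zeta i tau w) t in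
  let xbar t w : 'rV[R]_m := mean (x t w) in
  let Delta := f (mean (fun _ : 'I_N => y0)) - fstar in
  let avg_grad := ((T%:R^-1)%:E * \sum_(1 <= t < T.+1)
        'E_P[fun w => (enorm (gradient f (xbar t.-1 w)) ^+ 2)%R])%E in
  (0 < N)%N -> (N <= T)%N -> (0 < I)%N ->
  0 < L -> 0 < sigma -> 0 < G ->
  (forall i (y : 'rV[R]_m), (D i).-integrable setT (EFin \o F i y)) ->
  (forall i (s : S i) (y : 'rV[R]_m),
     differentiable (fun u => F i u s) y) ->
  is_minimum_value f fstar ->
  (forall i (y : 'rV[R]_m), differentiable (f_ i) y) ->
  (forall i (y u : 'rV[R]_m), enorm (gradient (f_ i) y - gradient (f_ i) u)
                 <= L * enorm (y - u)) ->
  (forall i (y : 'rV[R]_m), ('E_(D i)[fun s : S i => (enorm (gradient (fun u => F i u s) y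
                                         - gradient (f_ i) y) ^+ 2)%R]
                <= (sigma ^+ 2)%:E)%E) ->
  (forall i (y : 'rV[R]_m), ('E_(D i)[fun s : S i => (enorm (gradient (fun u => F i u s) y) ^+ 2)%R]
                <= (G ^+ 2)%:E)%E) ->
  (forall i t, (1 <= t <= T)%N -> forall A : set (S i), measurable A ->
     distribution P (zeta i t) A = D i A) ->
  mutually_independent (P := P) [set k : 'I_N * nat | (1 <= k.2 <= T)%N]
    (S := fun k => S k.1) (fun k => zeta k.1 k.2) ->
  (forall i t, (1 <= t <= T)%N -> forall j : 'I_m,
     is_cond_expectation P (history zeta t.-1)
       (fun w => gradient (fun u => F i u (zeta i t w)) (x t.-1 w i) 0 j)
       (fun w => gradient (f_ i) (x t.-1 w i) 0 j)) ->
  gamma = Num.sqrt N%:R / (L * Num.sqrt T%:R) ->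
  (avg_grad <= (2 * L / Num.sqrt (N * T)%:R * Delta
                + 4 * N%:R / T%:R * I%:R ^+ 2 * G ^+ 2
                + 1 / Num.sqrt (N * T)%:R * sigma ^+ 2)%:E)%E
  /\
  ((I%:R : R) <= T%:R `^ (1 / 4) / N%:R `^ (3 / 4) ->
   let bound := 2 * L / Num.sqrt (N * T)%:R * Delta
                + 4 / Num.sqrt (N * T)%:R * G ^+ 2
                + 1 / Num.sqrt (N * T)%:R * sigma ^+ 2 in
   (avg_grad <= bound%:E)%E /\
   `|bound| <= C L G sigma Delta * (1 / Num.sqrt (N * T)%:R)).
Proof.
exists (fun L G sigma Delta => `|2 * L * Delta + 4 * G ^+ 2 + sigma ^+ 2|).
move=> N m d S D F L sigma G fstar d0 Omega P zeta y0 gamma I T.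
move=> f_ f x xbar Delta avg_grad.
move=> N0 NT I0 L0 s0 G0 iF dF [_ fmin] df_ lip_ varF momF law indep cond.
move=> gammaE.
have T0 : (0 < T)%N := leq_trans N0 NT.
have mF i y : measurable_fun setT (F i y).
  by apply/measurable_EFinP; exact: measurable_int (iF i y).
have NR : (0 : R) < N%:R by rewrite ltr0n.
have TR : (0 : R) < T%:R by rewrite ltr0n.
have gamma0 : 0 <= gamma.
  by rewrite gammaE divr_ge0 ?mulr_ge0 ?sqrtr_ge0// ltW.
have gammaL : gamma * L <= 1.
  rewrite gammaE invfM mulrA mulrAC divfK ?gt_eqF//.
  by rewrite ler_pdivrMr ?sqrtr_gt0// mul1r ler_sqrt// ler_nat.
have bound := rate_arithmetic N0 T0 L0 gammaE
  (average_gradient_bound mF dF df_ lip_ varF momF law indep cond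
     N0 I0 (ltW L0) gamma0 fmin gammaL).
have avgE : avg_grad = (T%:R^-1 * \sum_(0 <= s < T)
    Ex P (fun w => enorm (gradient f (xbar s w)) ^+ 2))%:E.
  rewrite /avg_grad EFinM; congr (_ * _)%E.
  exact: (expectation_sum_gradient gamma I y0 mF dF df_ lip_ momF law indep
    N0 (ltW L0)).
rewrite avgE lee_fin; split=> [//|hI]; rewrite /= lee_fin; split.
  apply: (le_trans bound); rewrite lerD2r lerD2l.
  exact: short_interval_rate.
rewrite (_ : _ + _ + _ = (2 * L * Delta + 4 * G ^+ 2 + sigma ^+ 2) *
  (1 / Num.sqrt (N * T)%:R)); last ring.
by rewrite normrM [X in _ * X]ger0_norm// divr_ge0 ?sqrtr_ge0.
Qed.
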